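(* Let $m,N\in\mathbb{N}$, $r>0$, $\alpha>0$, $\beta\ge 0$, let $g:(0,\infty)\to(0,\infty)$ be a bounded and smooth function, and let $n\in\{1,\dots,N\}$. Assume that either (A1) $r>m$ and $\int_1^\infty t^{\alpha-Nm-1}e^{-\beta t}g(t)\,dt<\infty$, or (A2) $r=m$, $\int_0^1 t^{\alpha-N-1}e^{-\beta t}g(t)\,dt<\infty$, and $\int_1^\infty t^{\alpha-Nm-1}e^{-\beta t}g(t)\,dt<\infty$. Assume that $g$ is nonincreasing. Suppose further that $$\alpha+1\le\min\{\,n(m-2),\ nm/2+\beta r\,\}.$$ Then the hierarchical Bayes estimator $\hat p^{(\alpha,\beta,g)}=(\hat p^{(\alpha,\beta,g)}_{i,\nu})_{1\le i\le m,\,1\le\nu\le N}$, given by $$\hat p^{(\alpha,\beta,g)}_{i,\nu}=\frac{X_{i,\nu}}{r+X_{\cdot,\nu}-1+\delta^{(\alpha,\beta,g)}(X_{\cdot})}\ \text{ if } X_{i,\nu}\ge1,\qquad \hat p^{(\alpha,\beta,g)}_{i,\nu}=0\ \text{ if } X_{i,\nu}=0,$$ dominates the UMVU estimator $\hat p^{\mathrm U}=(\hat p^{\mathrm U}_{i,\nu})$, given by $\hat p^{\mathrm U}_{i,\nu}=X_{i,\nu}/(r+X_{\cdot,\nu}-1)$ if $X_{i,\nu}\ge1$ and $\hat p^{\mathrm U}_{i,\nu}=0$ if $X_{i,\nu}=0$, under the loss $$L_n(d,p)=\sum_{\nu=1}^{n}\sum_{i=1}^{m}\frac{1}{p_{i,\nu}}(d_{i,\nu}-p_{i,\nu})^2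 .$$
   Context: $\mathbb{N}=\{1,2,\dots\}$, $\mathbb{N}_0=\{0,1,2,\dots\}$. Let $D_m=\{(q_1,\dots,q_m)'\,:\,q_1,\dots,q_m>0,\ \sum_{i=1}^m q_i<1\}$. For $r>0$ and $q\in D_m$, with $q_0=1-\sum_{i=1}^m q_i$, the negative multinomial distribution $\mathrm{NM}_m(r,q)$ has probability mass function $$\mathrm{NM}_m(x\mid r,q)=\frac{\Gamma(r+\sum_{i=1}^m x_i)}{\Gamma(r)\prod_{i=1}^m x_i!}\,q_0^{\,r}\prod_{i=1}^m q_i^{x_i},\qquad x\in\mathbb{N}_0^m .$$ The observations $X_\nu=(X_{1,\nu},\dots,X_{m,\nu})'$, $\nu=1,\dots,N$, are independent with $X_\nu\sim\mathrm{NM}_m(r,p_\nu)$, where $r$ is known and $p=(p_1,\dots,p_N)\in D_m^N$, $p_\nu=(p_{1,\nu},\dots,p_{m,\nu})'$, is unknown. Put $X_{\cdot,\nu}=\sum_{i=1}^m X_{i,\nu}$ and $X_{\cdot}=(X_{\cdot,1},\dots,X_{\cdot,N})'$. For $\xi_0\ge0$ and $\xi=(\xi_1,\dots,\xi_N)'\in[0,\infty)^N$ define $$K(\alpha,\beta,g,\xi_0,\xi)=\int_0^\infty t^{\alpha-1}e^{-\beta t}g(t)\Big\{\prod_{\nu=1}^N\frac{\Gamma(t+\xi_0)}{\Gamma(t+\xi_0+\xi_\nu)}\Big\}dt .$$ With $j^{(N)}=(1,\dots,1)'\in\mathbb{R}^N$, define $\delta^{(\alpha,\beta,g)}:\mathbb{N}_0^N\to(0,\infty]$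 by $$\delta^{(\alpha,\beta,g)}(z)=\frac{K(\alpha+1,\beta,g,r-m,z+m j^{(N)})}{K(\alpha,\beta,g,r-m,z+m j^{(N)})}.$$ Under (A1) or (A2) the denominator is finite for all $z\in\mathbb{N}_0^N$ and the numerator is finite for all $z\ne 0$. The estimator $\hat p^{(\alpha,\beta,g)}$ is called the hierarchical Bayes estimator because it is the Bayes solution for the prior density $\int_0^\infty t^{\alpha-1}e^{-\beta t}g(t)\prod_{\nu=1}^N p_{0,\nu}^{\,t-m-1}\,dt$ on $D_m^N$, where $p_{0,\nu}=1-\sum_{i=1}^m p_{i,\nu}$. The risk of an estimator $\hat p=\hat p(X)\in\mathbb{R}^{m\times N}$ under a loss $L$ is $E_p[L(\hat p,p)]$. An estimator $\hat p$ dominates $\hat p^*$ under $L$ if $E_p[L(\hat p,p)]\le E_p[L(\hat p^*,p)]$ for all $p\in D_m^N$, with strict inequality for at least one $p$. *)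

(* Defs.v *)
From mathcomp Require Import all_boot all_order all_algebra.
From mathcomp Require Import all_classical all_reals all_analysis.

Set Implicit Arguments.
Unset Strict Implicit.
Unset Printing Implicit Defensive.

Import Order.TTheory GRing.Theory Num.Theory.
Import numFieldNormedType.Exports.

Local Open Scope classical_set_scope.
Local Open Scope ring_scope.

(* Euler's integral; only evaluated at positive arguments. *)
Definition Gamma (R : realType) (a : R) : R :=
  \int[@lebesgue_measure R]_(t in `]0, +oo[) (t `^ (a - 1) * expR (- t)).

Definition D_set (R : realType) (m : nat) : set 'cV[R]_m :=
  [set q | (forall i, 0 < q i 0) /\ \sum_i q i 0 < 1].

(* p \in D_m^N is stored as the m x N matrix whose nu-th column is p_nu. *)
Definition D_prod (R : realType) (m N : nat) : set 'M[R]_(m, N) :=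
  [set p | forall nu, D_set (col nu p)].
Arguments D_prod : clear implicits.

Definition NM_pmf (R : realType) (m : nat) (r : R) (q : 'cV[R]_m)
    (x : 'cV[nat]_m) : R :=
  Gamma (r + (\sum_i x i ord0)%N%:R) / (Gamma r * \prod_i ((x i ord0)`!)%:R)
  * (1 - \sum_i q i 0) `^ r * \prod_i q i 0 ^+ x i 0.

(* Mutual independence of a finite family of random elements of a countable
   space E with its discrete sigma-algebra: every subset of E is an event. *)
Definition mutually_independent (R : realType) (d : measure_display)
    (T : measurableType d) (P : probability T R) (I : finType) (E : countType)
    (Y : I -> T -> E) : Prop :=
  forall (J : {set I}) (A : I -> set E),
    P [set w | forall i, i \in J -> A i (Y i w)]
    = (\prod_(i in J) P (Y i @^-1` A i))%E.

(* The statistical model: under P_p, p \in D_m^N, the columns X_nu of X are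
   independent with X_nu ~ NM_m(r, p_nu). *)
Definition NM_model (R : realType) (d : measure_display)
    (T : measurableType d) (m N : nat) (r : R)
    (P : 'M[R]_(m, N) -> probability T R) (X : T -> 'M[nat]_(m, N)) : Prop :=
  (forall i nu, measurable_fun [set: T] (fun w => X w i nu)) /\
  (forall p, D_prod R m N p ->
    mutually_independent (P p) (fun nu w => col nu (X w)) /\
    forall nu (x : 'cV[nat]_m),
      P p [set w | col nu (X w) = x] = (NM_pmf r (col nu p) x)%:E).

Definition risk (R : realType) (d : measure_display) (T : measurableType d)
    (m N : nat) (P : 'M[R]_(m, N) -> probability T R)
    (X : T -> 'M[nat]_(m, N)) (L : 'M[R]_(m, N) -> 'M[R]_(m, N) -> R)
    (phat : 'M[nat]_(m, N) -> 'M[R]_(m, N)) (p : 'M[R]_(m, N)) : \bar R :=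
  ('E_(P p) [fun w => L (phat (X w)) p])%E.

Definition dominates (R : realType) (d : measure_display)
    (T : measurableType d) (m N : nat)
    (P : 'M[R]_(m, N) -> probability T R) (X : T -> 'M[nat]_(m, N))
    (L : 'M[R]_(m, N) -> 'M[R]_(m, N) -> R)
    (phat phat' : 'M[nat]_(m, N) -> 'M[R]_(m, N)) : Prop :=
  (forall p, D_prod R m N p ->
     (risk P X L phat p <= risk P X L phat' p)%E) /\
  (exists2 p, D_prod R m N p & (risk P X L phat p < risk P X L phat' p)%E).

Definition loss (R : realType) (m N n : nat) (a p : 'M[R]_(m, N)) : R :=
  \sum_(nu < N | (nu < n)%N) \sum_(i < m)
    (p i nu)^-1 * (a i nu - p i nu) ^+ 2.

Definition Kint (R : realType) (N : nat) (alpha beta : R) (g : R -> R)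
    (xi0 : R) (xi : 'I_N -> R) : \bar R :=
  (\int[@lebesgue_measure R]_(t in `]0%R, +oo[)
    (t `^ (alpha - 1) * expR (- beta * t) * g t *
     \prod_nu (Gamma (t + xi0) / Gamma (t + xi0 + xi nu)))%:E)%E.

(* An extended real: the numerator may be +oo at z = 0. *)
Definition delta (R : realType) (m N : nat) (r alpha beta : R) (g : R -> R)
    (z : 'I_N -> nat) : \bar R :=
  (Kint (alpha + 1) beta g (r - m%:R) (fun nu => ((z nu)%:R + m%:R)%R)
   / Kint alpha beta g (r - m%:R) (fun nu => ((z nu)%:R + m%:R)%R))%E.

Definition col_total (m N : nat) (x : 'M[nat]_(m, N)) (nu : 'I_N) : nat :=
  (\sum_(i < m) x i nu)%N.

Definition p_UMVU (R : realType) (m N : nat) (r : R) (x : 'M[nat]_(m, N)) :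
    'M[R]_(m, N) :=
  \matrix_(i, nu)
    if (1 <= x i nu)%N
    then (x i nu)%:R / (r + (col_total x nu)%:R - 1)
    else 0.

Definition p_HB (R : realType) (m N : nat) (r alpha beta : R) (g : R -> R)
    (x : 'M[nat]_(m, N)) : 'M[R]_(m, N) :=
  \matrix_(i, nu)
    if (1 <= x i nu)%N
    then fine ((x i nu)%:R%:E /
      ((r + (col_total x nu)%:R - 1)%:E
       + delta m r alpha beta g (col_total x)))%E
    else 0.

(* g is a total function of which only the values on ]0, +oo[ matter. *)
Definition smooth_pos (R : realType) (g : R -> R) : Prop :=
  forall (k : nat) (t : R), 0 < t -> derivable (derive1n k g) t 1.

Definition condA1 (R : realType) (m N : nat) (r alpha beta : R) (g : R -> R) :
    Prop :=
  m%:R < r /\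
  (\int[@lebesgue_measure R]_(t in `[1%R, +oo[)
     (t `^ (alpha - (N * m)%N%:R - 1) * expR (- beta * t) * g t)%:E < +oo)%E.

Definition condA2 (R : realType) (m N : nat) (r alpha beta : R) (g : R -> R) :
    Prop :=
  [/\ r = m%:R,
      (\int[@lebesgue_measure R]_(t in `]0%R, 1%R])
        (t `^ (alpha - N%:R - 1) * expR (- beta * t) * g t)%:E < +oo)%E
    & (\int[@lebesgue_measure R]_(t in `[1%R, +oo[)
        (t `^ (alpha - (N * m)%N%:R - 1) * expR (- beta * t) * g t)%:E
        < +oo)%E].

(* Main.v *)
Require Import Defs.
From HB Require Import structures.
From mathcomp Require Import all_boot all_order all_algebra.
From mathcomp Require Import all_classical all_reals all_analysis.
From mathcomp Require Import measurable_realfun ring lra.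

Import Order.TTheory GRing.Theory Num.Theory.
Import numFieldNormedType.Exports.

Local Open Scope classical_set_scope.
Local Open Scope ring_scope.

Set Implicit Arguments.
Unset Strict Implicit.
Unset Printing Implicit Defensive.

(**
  The risk of an estimator is the expectation of a function of X that no longer
  involves 1 / p, because shifting a coordinate of X by one turns 1 / p_ij into an
  explicit factor.  The difference of the two risks then only depends on the column
  totals z, and it is nonpositive for every z.

  Let t have the posterior density proportional to the integrand of K given z, write
  E for its expectation, and put d = E t = delta(z) and y = r + z_nu.  Raising z_nu
  by one divides the integrand by t + y, hence 1 / (y + delta(z + e_nu)) =
  E (1 / (t + y)).  With u = E (t / (t + y)) and s = E (t^2 / (t + y)) one has
  y u + s = d, and u <= d / (d + y) by concavity, which bounds the nu-th summand of
  the difference by w_nu ((z_nu + m) s_nu - (m - 2) d) for a positive weight w_nu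
  that decreases in z_nu.  Since (z_nu + m) s_nu increases in z_nu, Chebyshev's sum
  inequality applies, and integration by parts in t gives
  \sum_nu (z_nu + m) s_nu <= (alpha + 1) d <= n (m - 2) d.
*)

(** * Integrals over the positive half-line *)

(** Lebesgue measure and [l] times its image under multiplication by [l] agree on half-open
    intervals, hence on all measurable sets. Arguing with the measure instead of a change of
    variables asks only measurability of [f]. *)
Lemma ge0_integral_scale (R : realType) (l : R) (f : R -> R) :
  0 < l -> measurable_fun (`]0, +oo[ : set R) f ->
  (forall t, 0 < t -> 0 <= f t) ->
  (\int[@lebesgue_measure R]_(t in `]0%R, +oo[) (f t)%:E =
   l%:E * \int[@lebesgue_measure R]_(t in `]0%R, +oo[) (f (l * t)%R)%:E)%E.
Proof.
move=> l0 mf f0.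
have mEf : measurable_fun (`]0, +oo[%classic : set R) (EFin \o f).
  exact/measurable_EFinP.
pose phi : measurableTypeR R -> measurableTypeR R := fun x => l * x.
have mphi : measurable_fun setT phi.
  by apply: continuous_measurable_fun; exact: mulrl_continuous.
pose phi' : {mfun measurableTypeR R >-> measurableTypeR R} :=
  HB.pack phi (isMeasurableFun.Build _ _ _ _ _ mphi).
have pre : phi @^-1` `]0, +oo[%classic = `]0, +oo[%classic.
  apply/seteqP; split=> x /=; rewrite !in_itv/= !andbT /phi ?pmulr_rgt0//.
have preoc a b : phi @^-1` `]a, b]%classic = `]l^-1 * a, l^-1 * b]%classic.
  by apply/seteqP; split=> x /=; rewrite /phi !in_itv/= ltr_pdivrMl// ler_pdivlMl.
pose l' := NngNum (ltW l0).
have muE (A : set R) : measurable A ->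
    lebesgue_measure A = mscale l' (pushforward lebesgue_measure phi') A.
  move=> mA.
  apply: lebesgue_measure_unique => // _ [[a b]] _ <-.
  transitivity (l%:E * lebesgue_measure (`](l^-1 * a)%R, (l^-1 * b)%R]%classic : set R))%E; last first.
    by rewrite -preoc.
  rewrite /= !lebesgue_measure_itv/= !lte_fin ltr_pM2l ?invr_gt0//.
  case: ifPn => _; last by rewrite mule0.
  by rewrite -EFinM; congr EFin; field; rewrite gt_eqF.
rewrite (eq_measure_integral (mscale l' (pushforward lebesgue_measure phi'))); last first.
  by move=> A mA _; exact: muE.
rewrite ge0_integral_mscale//; first last.
  by move=> x; rewrite /= in_itv/= andbT => /f0; rewrite lee_fin.
congr (_ * _)%E.
rewrite ge0_integral_pushforward//; last first.
  by move=> x /[!inE]/=; rewrite in_itv/= andbT lee_fin => /f0.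
by rewrite /= pre.
Qed.

Lemma integral_powR_0_1 (R : realType) (a : R) : 0 < a ->
  (\int[@lebesgue_measure R]_(t in `]0%R, 1%R]) (t `^ (a - 1))%:E < +oo)%E.
Proof.
move=> a0.
pose F (n : nat) : set R := `[n.+2%:R^-1, 1]%classic.
have FE : `]0, 1]%classic = \bigcup_n F n.
  apply/seteqP; split=> x; rewrite /F /= ?in_itv/=.
    move=> /andP[x0 x1]; have := archi_boundP (ltW (_ : 0 < x^-1)).
    rewrite invr_gt0 => /(_ x0) xk.
    exists (Num.bound x^-1) => //=; rewrite in_itv/= x1 andbT.
    rewrite invf_ple ?posrE ?ltr0n//; apply: (le_trans (ltW xk)).
    by rewrite ler_nat -addn2 leq_addr.
  move=> [n _] /=; rewrite in_itv/= => /andP[nx ->]; rewrite andbT.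
  by apply: lt_le_trans nx; rewrite invr_gt0 ltr0n.
have mp (A : set R) : measurable A -> measurable_fun A (fun t : R => (t `^ (a - 1))%:E).
  by move=> mA; apply/measurable_EFinP/measurable_funTS; exact: measurable_powR.
have Fle n : (\int[@lebesgue_measure R]_(t in F n) (t `^ (a - 1))%:E <= (a^-1)%:E)%E.
  have n0 : 0 < n.+2%:R^-1 :> R by rewrite invr_gt0 ltr0n.
  have dG (x : R) : 0 < x -> is_derive x 1 (fun t : R => a^-1 * t `^ a) (x `^ (a - 1)).
    move=> x0.
    have := is_deriveZ (a^-1 : R) (is_derive1_powR a x0).
    by rewrite /GRing.scale/= mulrA mulVf ?gt_eqF// mul1r.
  have cG (x : R) : 0 < x -> {for x, continuous (fun t : R => a^-1 * t `^ a)}.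
    by move=> /dG [dx _]; apply/differentiable_continuous/derivable1_diffP.
  rewrite /F (@continuous_FTC2 _ _ (fun t => a^-1 * t `^ a)).
  - by rewrite powR1 mulr1 -EFinB lee_fin gerBl// mulr_ge0 ?powR_ge0// invr_ge0 ltW.
  - by rewrite invf_lt1 ?ltr0n// ltr1n.
  - apply: derivable_within_continuous => x; rewrite in_itv/= => /andP[nx _].
    by apply: derivable_powR; rewrite in_itv/= andbT; exact: lt_le_trans nx.
  - split.
    + move=> x; rewrite in_itv/= => /andP[nx _].
      by have [] := dG _ (lt_trans n0 nx).
    + exact/cvg_at_right_filter/cG.
    + exact/cvg_at_left_filter/cG.
  - move=> x; rewrite in_itv/= => /andP[nx _].
    by rewrite derive1E; have [_] := dG _ (lt_trans n0 nx).
rewrite FE; apply: (@le_lt_trans _ _ (a^-1)%:E); last exact: ltry.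
have ndF : nondecreasing_seq F.
  move=> i j ij; rewrite subsetEset /F; apply: subset_itvr.
  by rewrite bnd_simp lef_pV2 ?posrE ?ltr0n// ler_nat !ltnS.
have mF i : measurable (F i) by exact: measurable_itv.
have cF : (\int[@lebesgue_measure R]_(t in F i) (t `^ (a - 1))%:E @[i --> \oo] -->
    \int[@lebesgue_measure R]_(t in \bigcup_i F i) (t `^ (a - 1))%:E)%E.
  apply: ge0_nondecreasing_set_cvg_integral => //.
    by move=> i; exact: mp.
  by move=> i t _; rewrite lee_fin powR_ge0.
rewrite -(cvg_lim _ cF)//; apply: lime_le; last exact: nearW.
by apply/cvg_ex; eexists; exact: cF.
Qed.

Lemma integral_invsqr_1y (R : realType) :
  (\int[@lebesgue_measure R]_(t in `[1%R, +oo[) (t ^- 2)%:E < +oo)%E.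
Proof.
rewrite (@ge0_continuous_FTC2y _ _ (fun t : R => - t^-1) _ 0).
- by rewrite -EFinB ltry.
- by move=> x _; rewrite invr_ge0 sqr_ge0.
- apply: derivable_within_continuous => x; rewrite in_itv/= andbT => x1.
  by apply: derivableV => //; rewrite expf_neq0// gt_eqF// (lt_le_trans _ x1).
- rewrite -[X in _ --> X]oppr0; apply: cvgN.
  apply/gtr0_cvgV0; [exact: nbhs_pinfty_gt|exact: cvg_id].
- move=> x x1; apply: derivableN; apply: derivableV => //.
  by rewrite gt_eqF// (lt_trans _ x1).
- by apply: cvg_at_right_filter; apply: cvgN; apply: cvgV; rewrite ?oner_neq0.
- move=> x; rewrite in_itv/= andbT => x1.
  rewrite derive1E deriveN; last by apply: derivableV => //; rewrite gt_eqF// (lt_trans _ x1).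
  rewrite deriveV//; last by rewrite gt_eqF// (lt_trans _ x1).
  by rewrite derive_id /GRing.scale/= mulr1 opprK.
Qed.

Definition integrable0y (R : realType) (f : R -> R) : bool :=
  (@lebesgue_measure R).-integrable `]0, +oo[ (EFin \o f).

(** An infinite integral reads as 0 here, which is why linearity and monotonicity below carry
    [integrable0y] hypotheses. *)
Definition integral0y (R : realType) (f : R -> R) : R :=
  \int[@lebesgue_measure R]_(t in `]0, +oo[) f t.

Definition measurable0y (R : realType) (f : R -> R) : Prop :=
  measurable_fun (`]0, +oo[%classic : set R) f.

Lemma integrable0yP (R : realType) (f : R -> R) :
  measurable0y f ->
  (forall t, 0 < t -> 0 <= f t) ->
  (\int[@lebesgue_measure R]_(t in `]0%R, 1%R]) (f t)%:E < +oo)%E ->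
  (\int[@lebesgue_measure R]_(t in `[1%R, +oo[) (f t)%:E < +oo)%E ->
  integrable0y f.
Proof.
move=> mf f0 f01 f1y; apply/integrableP; split; first exact/measurable_EFinP.
have UE : `]0, +oo[%classic = `]0, 1]%classic `|` `]1, +oo[%classic :> set R.
  apply/seteqP; split=> x /=; rewrite !in_itv/= ?andbT.
    by move=> x0; have [x1|x1] := leP x 1; [left|right]; rewrite ?x0.
  by move=> [/andP[]//|]; exact: lt_trans.
have mfS (A : set R) : measurable A -> A `<=` `]0, +oo[ ->
    measurable_fun A (fun t => (f t)%:E).
  by move=> mA AD; apply/measurable_EFinP; apply: measurable_funS mf.
have m1y := mfS _ (measurable_itv `]1, +oo[) (_ : _ `<=` _).
rewrite (_ : integral _ _ _ = \int[@lebesgue_measure R]_(t in `]0%R, +oo[) (f t)%:E)%E; last first.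
  apply: eq_integral => x /[!inE]/=; rewrite in_itv/= andbT => /f0 fx.
  by rewrite ger0_norm.
rewrite UE ge0_integral_setU//=.
- apply: lte_add_pinfty => //; rewrite integral_itv_obnd_cbnd//.
  by apply: m1y => x /=; rewrite !in_itv/= !andbT; apply: lt_trans.
- by rewrite -UE; exact: mfS.
- move=> x /= x0; rewrite lee_fin; apply: f0.
  by case: x0; rewrite in_itv/= ?andbT; [case/andP|exact: lt_trans].
- apply/disj_setPS => x /= []; rewrite !in_itv/= andbT => /andP[_ x1].
  by rewrite ltNge x1.
Qed.

Lemma ge0_le_integrable0y (R : realType) (f g : R -> R) :
  measurable0y f ->
  (forall t, 0 < t -> 0 <= f t <= g t) ->
  integrable0y g ->
  integrable0y f.
Proof.
move=> mf fg ig; apply: le_integrable ig => //; first exact/measurable_EFinP.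
move=> t /=; rewrite in_itv/= andbT => /fg /andP[f0 fg'].
by rewrite lee_fin !ger0_norm// (le_trans f0).
Qed.

(** A zero integral would force [f] to vanish almost everywhere, so the half-line, on which [f]
    never vanishes, would be a null set. *)
Lemma integral0y_gt0 (R : realType) (f : R -> R) :
  (forall t, 0 < t -> 0 < f t) ->
  integrable0y f ->
  0 < integral0y f.
Proof.
move=> f0 fi.
have mf := measurable_int _ fi.
rewrite lt_neqAle Rintegral_ge0 ?andbT; last first.
  by move=> t /=; rewrite in_itv/= andbT => /f0/ltW.
apply/negP => /eqP/esym I0.
have {}I0 : (\int[@lebesgue_measure R]_(t in `]0%R, +oo[) `|(f t)%:E| = 0)%E.
  transitivity (\int[@lebesgue_measure R]_(t in `]0%R, +oo[) (f t)%:E)%E.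
    apply: eq_integral => t /[!inE]/=; rewrite in_itv/= andbT => /f0/ltW ft.
    by rewrite ger0_norm.
  by apply/eqP; rewrite -fine_eq0; [exact/eqP|exact: integrable_fin_num].
have [] := (ae_eq_integral_abs lebesgue_measure (measurable_itv `]0, +oo[) mf).1 I0.
move=> N [mN N0 sub].
have : (lebesgue_measure (`]0%R, +oo[%classic : set R) <= lebesgue_measure N)%E.
  apply: le_measure; rewrite ?inE//.
  apply: subset_trans sub => t /= t0 /(_ t0) [] /eqP.
  by move: t0; rewrite in_itv/= andbT => /f0; rewrite lt_def => /andP[/negP].
by rewrite N0 lebesgue_measure_itv/= ltry sube0 leye_eq.
Qed.

Section integral0y_algebra.
Context {R : realType}.
Implicit Types (f g : R -> R) (k : R).

Lemma measurable_integrable0y f : integrable0y f -> measurable0y f.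
Proof. by move=> /measurable_int/measurable_EFinP. Qed.

Lemma integrable0yD f g :
  integrable0y f -> integrable0y g -> integrable0y (fun t => f t + g t).
Proof. by move=> fi gi; exact: (integrableD _ fi gi). Qed.

Lemma integrable0yZ k f : integrable0y f -> integrable0y (fun t => k * f t).
Proof. by move=> fi; exact: (integrableZl _ k fi). Qed.

Lemma integral0yD f g : integrable0y f -> integrable0y g ->
  integral0y (fun t => f t + g t) = integral0y f + integral0y g.
Proof. by move=> fi gi; exact: RintegralD. Qed.

Lemma integral0yZ k f : integrable0y f ->
  integral0y (fun t => k * f t) = k * integral0y f.
Proof. by move=> fi; exact: RintegralZl. Qed.

Lemma le_integral0y f g : integrable0y f -> integrable0y g ->
  (forall t, 0 < t -> f t <= g t) -> integral0y f <= integral0y g.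
Proof.
move=> fi gi fg; apply: le_Rintegral => // t /=.
by rewrite in_itv/= andbT; exact: fg.
Qed.

Lemma eq_integral0y f g : (forall t, 0 < t -> f t = g t) ->
  integral0y f = integral0y g.
Proof.
move=> fg; apply: eq_Rintegral => t /[!inE]/=.
by rewrite in_itv/= andbT; exact: fg.
Qed.

Lemma eq_integrable0y f g : (forall t, 0 < t -> f t = g t) ->
  integrable0y f -> integrable0y g.
Proof.
move=> fg; apply: eq_integrable => // t /[!inE]/=.
by rewrite in_itv/= andbT => /fg; rewrite /= => ->.
Qed.

Lemma integral0y_ge0 f : (forall t, 0 < t -> 0 <= f t) -> 0 <= integral0y f.
Proof.
by move=> f0; apply: Rintegral_ge0 => t /=; rewrite in_itv/= andbT; exact: f0.
Qed.

End integral0y_algebra.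

Lemma integral0y_scale (R : realType) (l : R) (f : R -> R) :
  0 < l -> measurable0y f ->
  (forall t, 0 < t -> 0 <= f t) ->
  integral0y f = l * integral0y (fun t => f (l * t)).
Proof.
move=> l0 mf f0; rewrite /integral0y /Rintegral (ge0_integral_scale l0 mf)//.
have : (0 <= \int[@lebesgue_measure R]_(t in `]0%R, +oo[) (f (l * t))%:E)%E.
  by apply: integral_ge0 => t /=; rewrite in_itv/= andbT => t0; rewrite lee_fin f0// mulr_gt0.
(* If the dilated integral is infinite, so is its positive multiple, and both sides read as 0. *)
case: (\int[_]_(_ in _) _)%E => [x _|_|//]; first by [].
by rewrite gt0_muley ?lte_fin//= mulr0.
Qed.

Lemma integrable0y_scale (R : realType) (l : R) (f : R -> R) : 0 < l ->
  (forall t, 0 < t -> 0 <= f t) ->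
  integrable0y f -> integrable0y (fun t => f (l * t)).
Proof.
move=> l0 f0 fi; have mf := measurable_integrable0y fi.
apply/integrableP; split.
  apply/measurable_EFinP.
  rewrite -[X in measurable_fun _ X]/(f \o *%R l).
  apply: (measurable_comp _ _ mf) => //.
  by move=> _ [t /= t0 <-]; move: t0; rewrite !in_itv/= !andbT => t0; rewrite mulr_gt0.
have /integrableP[_] := fi.
have -> : (\int[@lebesgue_measure R]_(x in `]0%R, +oo[) `|(EFin \o f) x| =
    \int[@lebesgue_measure R]_(x in `]0%R, +oo[) (f x)%:E)%E.
  by apply: eq_integral => t /[!inE]/=; rewrite in_itv/= andbT => t0; rewrite ger0_norm ?f0.
rewrite (ge0_integral_scale l0 mf)//.
have -> : (\int[@lebesgue_measure R]_(x in `]0%R, +oo[) `|(EFin \o (fun t => f (l * t)%R)) x| =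
    \int[@lebesgue_measure R]_(x in `]0%R, +oo[) (f (l * x)%R)%:E)%E.
  apply: eq_integral => t /[!inE]/=; rewrite in_itv/= andbT => t0.
  by rewrite ger0_norm ?f0// mulr_gt0.
case: (\int[_]_(_ in _) _)%E => [x _||//]; first exact: ltry.
by rewrite gt0_muley ?lte_fin.
Qed.

(** Bernoulli's inequality with distinct increments. The sign of the sum is proved along with it
    because the induction discards the cross term [x i * \sum x]. *)
Lemma prod_1D_ge (R : realDomainType) (I : Type) (s : seq I) (x : I -> R) :
  all (fun i => 0 <= x i) s ->
  0 <= \sum_(i <- s) x i /\ 1 + \sum_(i <- s) x i <= \prod_(i <- s) (1 + x i).
Proof.
elim: s => [_|i s IH /= /andP[x0 /IH[S0 {}IH]]]; first by rewrite !big_nil addr0.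
rewrite !big_cons; split; first exact: addr_ge0.
apply: le_trans (ler_wpM2l _ IH); last by rewrite addr_ge0.
by rewrite mulrDl mul1r mulrDr mulr1; have := mulr_ge0 x0 S0; lra.
Qed.

Lemma measurable0y_inv (R : realType) (a : R) : 0 <= a ->
  measurable0y (fun t : R => (t + a)^-1).
Proof.
move=> a0; apply: (eq_measurable_fun (fun t : R => (t + a) `^ (-1))).
  move=> t /[!inE]/=; rewrite in_itv/= andbT => t0.
  by rewrite powR_inv1// addr_ge0// ltW.
apply: (@measurableT_comp _ _ _ _ _ _ (fun x : R => x `^ (-1))).
  exact: measurable_powR.
exact: measurable_funD.
Qed.

Lemma integrable0y_mul_sum (R : realType) (f : R -> R) (s : seq R) :
  all (fun a => 0 <= a) s -> (forall t, 0 < t -> 0 <= f t) -> integrable0y f ->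
  integrable0y (fun t => f t * \sum_(a <- s) t / (t + a)).
Proof.
elim: s => [_ _ _|a s IH /= /andP[a0 s0] f0 fi].
  apply: (@eq_integrable0y _ (fun=> 0)); last exact: integrable0.
  by move=> t _; rewrite big_nil mulr0.
have fai : integrable0y (fun t => f t * (t / (t + a))).
  apply: (ge0_le_integrable0y _ _ fi).
    apply: measurable_funM; first exact: measurable_integrable0y.
    by apply: measurable_funM => //; exact: measurable0y_inv.
  move=> t t0; have ta : 0 < t + a by rewrite ltr_pwDl.
  rewrite mulr_ge0 ?f0 ?divr_ge0 ?(ltW t0) ?(ltW ta)//= ler_piMr ?f0//.
  by rewrite ler_pdivrMr// mul1r lerDl.
apply: eq_integrable0y (integrable0yD fai (IH s0 f0 fi)) => t _.
by rewrite big_cons mulrDr.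
Qed.

(* Integration by parts without any regularity of h: f and its dilation
   t |-> (1 + e) * f ((1 + e) * t) have the same integral; let e tend to 0. *)
Lemma integral_log_derivative_le (R : realType) (c : R) (h : R -> R) (s : seq R) :
  let f t := t `^ c * h t * \prod_(a <- s) (t + a)^-1 in
  0 <= c -> all (fun a => 0 <= a) s ->
  (forall t, 0 < t -> 0 <= h t) -> {in `]0, +oo[ &, nonincreasing_fun h} ->
  integrable0y f ->
  integral0y (fun t => f t * \sum_(a <- s) t / (t + a)) <= (c + 1) * integral0y f.
Proof.
move=> f c0 s0 h0 hni fi.
have mf := measurable_integrable0y fi.
pose T (t : R) := \sum_(a <- s) t / (t + a).
pose n : R := (size s)%:R.
have T0n t : 0 < t -> 0 <= T t <= n.
  move=> t0; apply/andP; split.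
    rewrite /T big_seq; apply: sumr_ge0 => a /(allP s0) a0.
    by rewrite divr_ge0 ?(ltW t0)// addr_ge0// ltW.
  rewrite /n -sum1_size natr_sum /T big_seq [leRHS]big_seq; apply: ler_sum => a /(allP s0) a0.
  by rewrite ler_pdivrMr ?mul1r ?lerDl// ltr_pwDl.
have n0 : 0 <= n by rewrite ler0n.
have f0 t : 0 < t -> 0 <= f t.
  move=> t0; rewrite !mulr_ge0 ?powR_ge0 ?h0// big_seq; apply: prodr_ge0 => a /(allP s0) a0.
  by rewrite invr_ge0 addr_ge0// ltW.
have fTi : integrable0y (fun t => f t * T t) by exact: integrable0y_mul_sum.
set J := integral0y _; set I := integral0y f.
have I0 : 0 <= I by exact: integral0y_ge0.
have main e : 0 < e -> J <= (c + 1) * I + e * (n ^+ 2 * I).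
  move=> e0.
  have e1 : 0 < 1 + e by lra.
  have pt t : 0 < t -> f ((1 + e) * t) <=
      (1 + e) `^ c * (f t - e * (f t * T t) + e ^+ 2 * n ^+ 2 * f t).
    move=> t0; have ta a : a \in s -> 0 < t + a by move=> /(allP s0) ?; rewrite ltr_pwDl.
    have [|_ ] := @prod_1D_ge _ _ s (fun a => e * (t / (t + a))).
      by apply/allP => a /ta a0; rewrite mulr_ge0 ?divr_ge0 ?(ltW e0) ?(ltW t0) ?(ltW a0).
    rewrite -mulr_sumr -/(T t) => ge1; have /andP[T0 Tn] := T0n _ t0.
    have eT0 : 0 <= e * T t by rewrite mulr_ge0// ltW.
    (* For [x >= 0], [1 / (1 + x) <= 1 - x + x ^+ 2]. Since [T <= n], the quadratic term is bounded
       by a constant and integrates to a multiple of [I]. *)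
    have le2 : (\prod_(a <- s) (1 + e * (t / (t + a))))^-1 <= 1 - e * T t + e ^+ 2 * n ^+ 2.
      apply: (@le_trans _ _ (1 + e * T t)^-1).
        by rewrite lef_pV2 ?posrE//; lra.
      apply: (@le_trans _ _ (1 - e * T t + (e * T t) ^+ 2)); last first.
        by rewrite lerD2l exprMn ler_wpM2l ?sqr_ge0// ler_sqr ?nnegrE.
      rewrite -[leLHS]mul1r ler_pdivrMr; last by lra.
      by have := exprn_ge0 3 eT0; nra.
    have -> : f t - e * (f t * T t) + e ^+ 2 * n ^+ 2 * f t =
        f t * (1 - e * T t + e ^+ 2 * n ^+ 2) by ring.
    apply: le_trans (ler_wpM2l _ (ler_wpM2l _ le2)); last 2 first.
    - exact: powR_ge0.
    - exact: f0.
    rewrite /f powRM ?(ltW e1) ?(ltW t0)//.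
    have -> : \prod_(a <- s) ((1 + e) * t + a)^-1 =
        \prod_(a <- s) (t + a)^-1 * (\prod_(a <- s) (1 + e * (t / (t + a))))^-1.
      rewrite -prodfV -big_split/=; apply: eq_big_seq => a /ta a0.
      have et0 := mulr_gt0 e0 t0.
      by field; rewrite !gt_eqF//; lra.
    set Q := \prod_(a <- s) _; set Q' := (\prod_(a <- s) _)^-1.
    have Q0 : 0 <= Q * Q'.
      rewrite mulr_ge0//; last first.
        by rewrite invr_ge0; apply: le_trans ge1; rewrite addr_ge0.
      by rewrite /Q big_seq; apply: prodr_ge0 => a /ta/ltW; rewrite invr_ge0.
    rewrite -!mulrA ler_wpM2l ?powR_ge0// ler_wpM2l ?powR_ge0//.
    rewrite ler_wpM2r// hni ?in_itv/= ?andbT ?mulr_gt0//; last first.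
    by rewrite ler_peMl ?(ltW t0)//; lra.
  (* The change of variables contributes one more factor [1 + e], which turns the exponent [c] into
     [c + 1]. *)
  have le1 : I <= (1 + e) `^ (c + 1) * (I - e * J + e ^+ 2 * n ^+ 2 * I).
    pose G t := f t + - e * (f t * T t) + e ^+ 2 * n ^+ 2 * f t.
    have efTi := integrable0yZ (- e) fTi.
    have efi := integrable0yZ (e ^+ 2 * n ^+ 2) fi.
    have fBi := integrable0yD fi efTi.
    have Gi := integrable0yD fBi efi.
    have GE : integral0y G = I - e * J + e ^+ 2 * n ^+ 2 * I.
      by rewrite !integral0yD// !integral0yZ// mulNr.
    have -> : (1 + e) `^ (c + 1) = (1 + e) `^ c * (1 + e).
      by rewrite powRD ?powRr1 ?(ltW e1)// (gt_eqF e1) implybT.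
    rewrite {1}/I (integral0y_scale e1)//.
    rewrite (mulrC (_ `^ c)) -[leRHS]mulrA (ler_pM2l e1) -GE -integral0yZ//.
    have cGi := integrable0yZ ((1 + e) `^ c) Gi.
    have ptG t : 0 < t -> f ((1 + e) * t) <= (1 + e) `^ c * G t.
      by move=> /pt; rewrite /G mulNr.
    by apply: le_integral0y => //; exact: integrable0y_scale.
  (* From [ln (1 + e) <= e], the inverse power is at least [1 - (c + 1) * e]. Cancelling [I] and
     dividing by [e] then leaves an error of order [e]. *)
  have le2 : I * (1 - (c + 1) * e) <= I - e * J + e ^+ 2 * n ^+ 2 * I.
    apply: (@le_trans _ _ (I * ((1 + e) `^ (c + 1))^-1)); last first.
      by rewrite ler_pdivrMr ?powR_gt0// mulrC.
    rewrite ler_wpM2l// -powRN /powR gt_eqF//.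
    apply: le_trans (expR_ge1Dx _); rewrite lerD2l mulNr lerN2.
    by rewrite ler_wpM2l ?addr_ge0// le_ln1Dx//; lra.
  rewrite -(ler_pM2l e0); move: le2; lra.
apply/ler_addgt0Pr => e e0.
(* With [e / d] in place of [e] the error is at most [e]; the added 1 keeps [d] positive. *)
pose d := n ^+ 2 * I + 1.
have d0 : 0 < d by rewrite ltr_wpDl// mulr_ge0// sqr_ge0.
apply: le_trans (main (e / d) _) _; first by rewrite divr_gt0.
rewrite lerD2l mulrAC ler_pdivrMr// ler_wpM2l ?(ltW e0)// /d; lra.
Qed.

(** * The Gamma function *)

Lemma expRN_le (R : realType) (n : nat) (t : R) : 0 < t ->
  expR (- t) <= n.+1`!%:R / t ^+ n.+1.
Proof.
move=> t0; have tn : 0 < t ^+ n.+1 by rewrite exprn_gt0.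
rewrite expRN ler_pdivlMr// mulrC ler_pdivrMr ?expR_gt0//.
rewrite -ler_pdivrMl ?ltr0n ?fact_gt0// mulrC.
by apply: le_trans (expR_ge1Dxn n (ltW t0)); rewrite lerDr.
Qed.

Lemma integrable0y_Gamma (R : realType) (a : R) : 0 < a ->
  integrable0y (fun t => t `^ (a - 1) * expR (- t)).
Proof.
move=> a0.
have mE : measurable_fun setT (fun t : R => t `^ (a - 1) * expR (- t)).
  apply: measurable_funM; first exact: measurable_powR.
  by apply: measurableT_comp => //; exact: measurable_expR.
apply: integrable0yP.
- exact: measurable_funTS.
- by move=> t _; rewrite mulr_ge0 ?powR_ge0 ?expR_ge0.
- apply: le_lt_trans (integral_powR_0_1 a0); apply: ge0_le_integral => //=.
  + by move=> t _; rewrite lee_fin mulr_ge0 ?powR_ge0 ?expR_ge0.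
  + by apply/measurable_EFinP; exact: measurable_funTS.
  + by apply/measurable_EFinP/measurable_funTS; exact: measurable_powR.
  + move=> t; rewrite in_itv/= => /andP[t0 _].
    by rewrite lee_fin ler_piMr ?powR_ge0// expR_le1 oppr_le0 ltW.
have mV : measurable_fun (`[1, +oo[%classic : set R) (fun t : R => (t ^- 2)%:E).
  apply/measurable_EFinP; apply: (eq_measurable_fun (fun t : R => t `^ (- 2%:R))).
    move=> t /[!inE]/=; rewrite in_itv/= andbT => t1.
    by rewrite powR_invn// (le_trans _ t1).
  by apply: measurable_funTS; exact: measurable_powR.
(* As [n] exceeds [a + 1], the exponent [a - 1 - (n + 1)] is below -2. *)
pose n := Num.bound (a + 1).
apply: (@le_lt_trans _ _ (\int[@lebesgue_measure R]_(t in `[1%R, +oo[) ((n.+1`!%:R)%:E * (t ^- 2)%:E))%E).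
  apply: ge0_le_integral => //=.
  + by move=> t _; rewrite lee_fin mulr_ge0 ?powR_ge0 ?expR_ge0.
  + by apply/measurable_EFinP; exact: measurable_funTS.
  + exact: measurable_funeM.
  + move=> t; rewrite in_itv/= andbT => t1.
    have t0 : 0 < t by apply: lt_le_trans t1.
    rewrite -EFinM lee_fin.
    apply: le_trans (ler_wpM2l (powR_ge0 _ _) (expRN_le n t0)) _.
    rewrite mulrCA ler_wpM2l ?ler0n// -powR_mulrn ?(ltW t0)// -powR_mulrn ?(ltW t0)//.
    rewrite -!powRN -powRD ?(gt_eqF t0) ?implybT//.
    apply: ler_powR => //; rewrite -natr1.
    have := archi_boundP (_ : 0 <= a + 1); rewrite addr_ge0 ?(ltW a0)// => /(_ isT).
    by rewrite -/n; lra.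
rewrite ge0_integralZl//=; last first.
  by move=> t _; rewrite lee_fin invr_ge0 sqr_ge0.
by rewrite lte_mul_pinfty ?lee_fin ?ler0n// integral_invsqr_1y.
Qed.

Lemma Gamma_gt0 (R : realType) (a : R) : 0 < a -> 0 < Gamma a.
Proof.
move=> a0; apply: integral0y_gt0 (integrable0y_Gamma a0) => t t0.
by rewrite mulr_gt0 ?expR_gt0 ?powR_gt0.
Qed.

(* Dilating Euler's integral by 1 + x and bounding expR (- x * t) below by its
   tangent gives an inequality that is sharp at x = 0; both signs of x are used. *)
Lemma Gamma_add1 (R : realType) (a : R) : 0 < a -> Gamma (a + 1) = a * Gamma a.
Proof.
move=> a0.
have G0 := Gamma_gt0 a0.
have ineq x : -1 < x -> 0 < 1 + x + a * x ->
    0 <= Gamma a * (- (a * x) / (1 + x + a * x)) + x * Gamma (a + 1).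
  move=> x1 xa; have x10 : 0 < 1 + x by lra.
  have iG := integrable0y_Gamma a0.
  have tE t : 0 < t -> t * (t `^ (a - 1) * expR (- t)) = t `^ (a + 1 - 1) * expR (- t).
    by move=> t0; rewrite addrK mulrA mulr_powRB1// ltW.
  have iGS : integrable0y (fun t => t * (t `^ (a - 1) * expR (- t))).
    have iG1 : integrable0y (fun t => t `^ (a + 1 - 1) * expR (- t)).
      by apply: integrable0y_Gamma; rewrite addr_gt0.
    by apply: eq_integrable0y iG1 => t t0; rewrite tE.
  have GSE : Gamma (a + 1) = integral0y (fun t => t * (t `^ (a - 1) * expR (- t))).
    by apply: eq_integral0y => t t0; rewrite tE.
  (* The constant cancels the power of [1 + x] that the dilation produces. *)
  pose g t := (1 + x) `^ (1 - a) * (t `^ (a - 1) * expR (- t)).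
  have ig : integrable0y g by exact: integrable0yZ.
  have gE t : 0 < t -> g ((1 + x) * t) = t `^ (a - 1) * expR (- t) * expR (- (x * t)).
    move=> t0; rewrite /g powRM ?(ltW x10) ?(ltW t0)// -!mulrA mulrA.
    rewrite -powRD ?(gt_eqF x10) ?implybT// addrA subrK subrr powRr0 mul1r.
    by rewrite -expRD; congr (_ * expR _); ring.
  have g0 t : 0 < t -> 0 <= g t by move=> t0; rewrite !mulr_ge0 ?powR_ge0 ?expR_ge0.
  have IgE := integral0y_scale x10 (measurable_integrable0y ig) g0.
  rewrite integral0yZ// -/(Gamma a) in IgE.
  have isg := integrable0y_scale x10 g0 ig.
  have ge1 : Gamma a - x * Gamma (a + 1) <= integral0y (fun t => g ((1 + x) * t)).
    rewrite GSE -mulNr -integral0yZ// -integral0yD//; last exact: integrable0yZ.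
    apply: le_integral0y => //; first by apply: integrable0yD => //; exact: integrable0yZ.
    move=> t t0; rewrite gE// mulrA -[X in X + _]mul1r -mulrDl mulrC.
    rewrite ler_wpM2l ?mulr_ge0 ?powR_ge0 ?expR_ge0// mulNr.
    exact: expR_ge1Dx.
  (* The integral equals [Gamma a / (1 + x)]^ a[, and](1 + x) [^ a >= 1 + a * x / (1 + x)] because
     [ln (1 + x) >= x / (1 + x)]. A rational bound keeps the rest algebraic. *)
  have le1 : integral0y (fun t => g ((1 + x) * t)) <= Gamma a * ((1 + x) / (1 + x + a * x)).
    have -> : integral0y (fun t => g ((1 + x) * t)) = Gamma a * ((1 + x) `^ a)^-1.
      apply: (mulfI (lt0r_neq0 x10)); rewrite -IgE mulrCA mulrC; congr (_ * _).
      by rewrite -powRN powRD ?(gt_eqF x10) ?implybT// powRr1// ltW.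
    rewrite ler_pM2l// -[X in _ <= X]invf_div lef_pV2 ?posrE ?powR_gt0//; last exact: divr_gt0.
    rewrite /powR (gt_eqF x10)//; apply: le_trans (expR_ge1Dx _).
    have -> : (1 + x + a * x) / (1 + x) = 1 + a * (x / (1 + x)).
      by field; rewrite gt_eqF.
    rewrite lerD2l ler_pM2l// -[X in ln X]invrK lnV ?posrE ?invr_gt0//.
    rewrite lerNr.
    rewrite [X in ln X](_ : _ = 1 + - (x / (1 + x))); last by field; rewrite gt_eqF.
    apply: le_ln1Dx.
    by rewrite ltrN2 ltr_pdivrMr// mul1r ltrDr.
  have -> : - (a * x) / (1 + x + a * x) = (1 + x) / (1 + x + a * x) - 1.
    by field; rewrite gt_eqF.
  rewrite mulrBr mulr1 -addrA [- _ + _]addrC -opprB subr_ge0.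
  exact: le_trans ge1 le1.
apply/eqP; rewrite eq_le; apply/andP; split; apply/ler_addgt0Pr => e e0.
  have aG0 : 0 < a * Gamma a by exact: mulr_gt0.
  have aGe0 : 0 < a * Gamma a + e by exact: addr_gt0.
  (* Chosen so that [ineq] at [x = - d] reads exactly [Gamma (a + 1) <= a * Gamma a + e]. *)
  pose d := e / (a * Gamma a + e) / (1 + a).
  have d0 : 0 < d by rewrite !divr_gt0//; lra.
  have dE : (1 + a) * d = e / (a * Gamma a + e) by rewrite /d; field; rewrite !gt_eqF//; lra.
  have dE' : 1 + - d + a * (- d) = a * Gamma a / (a * Gamma a + e).
    have -> : 1 + - d + a * (- d) = 1 - (1 + a) * d by ring.
    by rewrite dE; field; rewrite !gt_eqF.
  have d1 : -1 < - d.
    have : 0 < 1 + - d + a * (- d) by rewrite dE' divr_gt0.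
    have := mulr_gt0 a0 d0; lra.
  have := ineq (- d) d1; rewrite dE' => /(_ (divr_gt0 aG0 aGe0)).
  have -> : Gamma a * (- (a * - d) / (a * Gamma a / (a * Gamma a + e))) + - d * Gamma (a + 1)
    = d * (a * Gamma a + e - Gamma (a + 1)) by field; rewrite !gt_eqF.
  by rewrite pmulr_rge0// subr_ge0.
have aG0 : 0 < a * Gamma a by exact: mulr_gt0.
(* At [x = d], [ineq] gives [Gamma (a + 1) >= (a * Gamma a) ^+ 2 / (a * Gamma a + e)], which is at
   least [a * Gamma a - e]. *)
pose d := e / (a * Gamma a) / (1 + a).
have d0 : 0 < d by rewrite !divr_gt0//; lra.
have dE' : 1 + d + a * d = (a * Gamma a + e) / (a * Gamma a).
  by rewrite /d; field; rewrite !gt_eqF//; lra.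
have aGe0 : 0 < a * Gamma a + e by exact: addr_gt0.
have := ineq d; rewrite dE' => /(_ _ (divr_gt0 aGe0 aG0)).
have -> : Gamma a * (- (a * d) / ((a * Gamma a + e) / (a * Gamma a))) + d * Gamma (a + 1)
    = d * (Gamma (a + 1) - (a * Gamma a) ^+ 2 / (a * Gamma a + e)) by field; rewrite !gt_eqF.
rewrite pmulr_rge0// subr_ge0 => H; have {H}/H H : -1 < d by lra.
rewrite -lerBlDr; apply: le_trans H; rewrite ler_pdivlMr//.
by rewrite -subr_ge0 (_ : _ - _ = e ^+ 2) ?sqr_ge0//; ring.
Qed.

Lemma Gamma_addn (R : realType) (a : R) (n : nat) : 0 < a ->
  Gamma (a + n%:R) = (\prod_(k < n) (a + k%:R)) * Gamma a.
Proof.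
move=> a0; elim: n => [|n IH]; first by rewrite big_ord0 addr0 mul1r.
by rewrite big_ord_recr/= -natr1 addrA Gamma_add1 ?IH ?ltr_wpDr// mulrCA mulrA.
Qed.

(** * The pointwise risk inequality *)

(* Expand \sum_(i, j) (a i - a j) * (b i - b j) <= 0. *)
Lemma chebyshev_sum_le (R : realFieldType) (I : finType) (P : pred I) (a b : I -> R) :
  (forall i j, (a i - a j) * (b i - b j) <= 0) ->
  #|P|%:R * \sum_(i | P i) a i * b i <=
  (\sum_(i | P i) a i) * (\sum_(i | P i) b i).
Proof.
move=> ab.
set A := \sum_(i | P i) a i; set B := \sum_(i | P i) b i; set C := \sum_(i | P i) a i * b i.
have sc (x : R) : \sum_(i | P i) x = #|P|%:R * x.
  by rewrite (eq_bigl (mem P))// sumr_const mulr_natl.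
have : \sum_(i | P i) \sum_(j | P j) (a i - a j) * (b i - b j) <= 0.
  by apply: sumr_le0 => i _; apply: sumr_le0 => j _; exact: ab.
have -> : \sum_(i | P i) \sum_(j | P j) (a i - a j) * (b i - b j) =
    #|P|%:R * C - A * B + (#|P|%:R * C - A * B).
  transitivity (\sum_(i | P i) (#|P|%:R * (a i * b i) - a i * B + (C - A * b i))).
    apply: eq_bigr => i _.
    rewrite (eq_bigr (fun j => a i * b i - a i * b j + (a j * b j - a j * b i))); last first.
      by move=> j _; ring.
    by rewrite !(big_split, sumrN)/= -!mulr_sumr -mulr_suml sc mulrCA.
  by rewrite !(big_split, sumrN)/= -!mulr_sumr -!mulr_suml sc.
by lra.
Qed.

Lemma card_ord_lt (N n : nat) : (n <= N)%N -> #|[pred i : 'I_N | (i < n)%N]| = n.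
Proof.
move=> nN; rewrite -sum1_card.
by rewrite (eq_bigl (fun i : 'I_N => (i < n)%N))// (big_ord_narrow nN)/= sum1_card card_ord.
Qed.

(** Times [d], the left side is the cost in the linear part of the risk of adding [d] to the
    denominator; the right side is the weight [w] of the next lemma times [z + 2]. With denominators
    cleared, the difference is a polynomial in [d] whose coefficients are nonnegative because
    [r + z >= z + 3]. *)
Lemma shrinkage_coef_le (R : realFieldType) (z d r : R) :
  0 <= z -> 0 < d -> 3 <= r ->
  2 * z / ((r + z - 1) * (r + z - 1 + d)) <=
  (2 * (r + z) + d) / ((r + z) ^+ 2 * (r + z + d)) * (z + 2).
Proof.
move=> z0 d0 r3; set y := r + z.
have y3 : 3 <= y by rewrite /y; lra.
have yz : z + 3 <= y by rewrite /y; lra.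
rewrite [leRHS]mulrAC ler_pdivlMr; last by rewrite mulr_gt0 ?exprn_gt0//; lra.
rewrite [leLHS]mulrAC ler_pdivrMr; last by rewrite mulr_gt0//; lra.
rewrite -subr_ge0.
have -> : (2 * y + d) * (z + 2) * ((y - 1) * (y - 1 + d)) - 2 * z * (y ^+ 2 * (y + d)) =
  2 * y * (2 * y * (y - z - 2) + z + 2) +
  d * (z * y * (y - 4) + z + (6 * y ^+ 2 - 8 * y + 2)) + d ^+ 2 * ((z + 2) * (y - 1)) by ring.
rewrite !addr_ge0// mulr_ge0 ?sqr_ge0//; try lra.
- by rewrite !addr_ge0// ?mulr_ge0//; lra.
- have h1 : 0 <= z * (y * (y - 3)) by rewrite !mulr_ge0//; lra.
  have h2 : 0 <= y * (y - 3 - z) by rewrite mulr_ge0//; lra.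
  have h3 : 0 <= y * (y - 3) by rewrite mulr_ge0//; lra.
  by move: h1 h2 h3; lra.
- by rewrite mulr_ge0//; lra.
Qed.

(** The algebraic half of the argument: the posterior means enter only as numbers [u], [s], [d]
    subject to the listed relations. *)
Lemma shrinkage_sum_le (R : realFieldType) (N n : nat) (z s u : 'I_N -> R) (m r d a : R) :
  (0 < n <= N)%N -> 0 <= m -> 3 <= r -> 0 < d ->
  (forall i, 0 <= z i) -> (forall i, 0 <= s i) ->
  (forall i, (r + z i) * u i + s i = d) ->
  (forall i, 0 <= u i <= d / (d + (r + z i))) ->
  (forall i j, z i <= z j -> (z i + m) * s i <= (z j + m) * s j) ->
  \sum_(i < N | (i < n)%N) (z i + m) * s i <= a * d ->
  a <= n%:R * (m - 2) ->
  \sum_(i < N | (i < n)%N)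
    ((z i + m) / (r + z i) * (1 - u i) ^+ 2 - 2 * (z i / (r + z i - 1 + d))) <=
  \sum_(i < N | (i < n)%N) ((z i + m) / (r + z i) - 2 * (z i / (r + z i - 1))).
Proof.
move=> /andP[n0 nN] m0 r3 d0 z0 s0 us ud bmon bsum an.
pose b i := (z i + m) * s i.
pose w i := (2 * (r + z i) + d) / ((r + z i) ^+ 2 * (r + z i + d)).
(* In this form [w] is visibly decreasing in [z i]. *)
have wE i : w i = ((r + z i) ^+ 2)^-1 + ((r + z i) * (r + z i + d))^-1.
  have := z0 i; rewrite /w => zi; field.
  by rewrite !gt_eqF//; lra.
have w0 i : 0 <= w i.
  have zi := z0 i; rewrite wE addr_ge0// invr_ge0 ?sqr_ge0// mulr_ge0//; lra.
have wanti i j : z i <= z j -> w j <= w i.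
  move=> zij; have zi := z0 i; have zj := z0 j; rewrite !wE; apply: lerD.
    rewrite lef_pV2 ?posrE ?exprn_gt0//; try lra.
    by rewrite ler_sqr ?nnegrE//; lra.
  rewrite lef_pV2 ?posrE ?mulr_gt0//; try lra.
  by apply: ler_pM; lra.
have term i : (z i + m) / (r + z i) * (1 - u i) ^+ 2 - 2 * (z i / (r + z i - 1 + d)) -
    ((z i + m) / (r + z i) - 2 * (z i / (r + z i - 1))) <=
    w i * b i - (m - 2) * d * w i.
  have zi := z0 i; have /andP[u0 ule] := ud i.
  have co := shrinkage_coef_le zi d0 r3; rewrite -/(w i) in co.
  set y := r + z i in us ud u0 ule co *.
  have y3 : 3 <= y by rewrite /y; lra.
  have yd : 0 < d + y by lra.
  (* Only one of the two factors is estimated by [u i <= d / (d + y)]. The other is rewritten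
     exactly as [(d - s i) / y], so that [s i] enters linearly with weight [w i]. *)
  have h1 : u i * ((2 * y + d) / (y + d)) <= u i * (2 - u i).
    rewrite ler_wpM2l//.
    have -> : (2 * y + d) / (y + d) = 2 - d / (d + y) by field; rewrite !gt_eqF//; lra.
    lra.
  have uE : u i = (d - s i) / y.
    by rewrite -(us i) -/y; field; rewrite gt_eqF//; lra.
  have h2 : (z i + m) * w i * (d - s i) <= (z i + m) / y * (u i * (2 - u i)).
    apply: le_trans (ler_wpM2l _ h1); last by rewrite divr_ge0//; lra.
    rewrite [in leRHS]uE /w -/y le_eqVlt; apply/orP; left; apply/eqP; field.
    by rewrite !gt_eqF//; lra.
  have h3 : 2 * (z i / (y - 1)) - 2 * (z i / (y - 1 + d)) =
      d * (2 * z i / ((y - 1) * (y - 1 + d))).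
    by field; rewrite !gt_eqF//; lra.
  have h4 : d * (2 * z i / ((y - 1) * (y - 1 + d))) <= d * (w i * (z i + 2)).
    by rewrite ler_pM2l.
  have h5 : (z i + m) / y * (1 - u i) ^+ 2 - (z i + m) / y = - ((z i + m) / y * (u i * (2 - u i))) by ring.
  have -> : w i * b i - (m - 2) * d * w i = d * (w i * (z i + 2)) - (z i + m) * w i * (d - s i).
    by rewrite /b; ring.
  lra.
rewrite -subr_le0 -sumrB; apply: le_trans (ler_sum _ (fun i _ => term i)) _.
rewrite sumrB -mulr_sumr.
have := chebyshev_sum_le (fun i : 'I_N => (i < n)%N) (a := w) (b := b).
rewrite [#|_|](card_ord_lt nN) => cheb.
set A := \sum_(i < N | (i < n)%N) w i in cheb *; set B := \sum_(i < N | _) b i in cheb.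
have A0 : 0 <= A by apply: sumr_ge0.
have nR : 0 < n%:R :> R by rewrite ltr0n.
rewrite -(ler_pM2l nR) mulr0 mulrBr subr_le0; apply: le_trans (cheb _) _.
  move=> i j; have [zij|/ltW zij] := leP (z i) (z j).
    by rewrite mulr_ge0_le0// ?subr_ge0 ?subr_le0 ?wanti ?bmon.
  by rewrite mulr_le0_ge0// ?subr_ge0 ?subr_le0 ?wanti ?bmon.
apply: (le_trans (ler_wpM2l A0 bsum)).
have -> : A * (a * d) = A * d * a by ring.
have -> : n%:R * ((m - 2) * d * A) = A * d * (n%:R * (m - 2)) by ring.
by rewrite ler_wpM2l// mulr_ge0// ltW.
Qed.

Lemma integral0y_sum (R : realType) (I : finType) (f : I -> R -> R) :
  (forall i, integrable0y (f i)) ->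
  integral0y (fun t => \sum_i f i t) = \sum_i integral0y (f i).
Proof.
move=> fi.
suff [] : integrable0y (fun t => \sum_i f i t) /\
  integral0y (fun t => \sum_i f i t) = \sum_i integral0y (f i) by [].
elim: (index_enum I) => [|i l [IHi IHI]].
  split.
    apply: (@eq_integrable0y _ (fun=> 0)); first by move=> t _; rewrite big_nil.
    exact: integrable0.
  transitivity (integral0y (fun _ : R => 0 : R)).
    by apply: eq_integral0y => t _; rewrite big_nil.
  by rewrite big_nil /integral0y Rintegral_cst//= mul0r.
have E t : f i t + \sum_(j <- l) f j t = \sum_(j <- i :: l) f j t by rewrite big_cons.
split; first by apply: eq_integrable0y (integrable0yD (fi i) IHi) => t _.
rewrite big_cons -IHI -integral0yD//.
by apply: eq_integral0y => t _; rewrite big_cons.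
Qed.

Definition incr_at (N : nat) (z : 'I_N -> nat) (nu : 'I_N) : 'I_N -> nat :=
  fun i => (z i + (i == nu))%N.

(** Presents every nonzero [z] as a successor, so that facts about [W] at an increased argument
    apply to it. *)
Lemma incr_at_decr (N : nat) (z : 'I_N -> nat) (k : 'I_N) :
  z k != 0%N -> incr_at (fun i => (z i - (i == k))%N) k = z.
Proof.
move=> zk; apply/funext => i; rewrite /incr_at subnK//.
by case: eqVneq => // ->; rewrite lt0n.
Qed.

(** The division by [t + y] that comes with raising a coordinate absorbs the extra factor [t], as
    [t / (t + y) <= 1]. This makes the posterior mean finite away from [z = 0]. *)
Lemma integrable0y_id_mul (R : realType) (y : R) (f h : R -> R) : 0 <= y ->
  (forall t, 0 < t -> 0 <= f t) -> integrable0y f ->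
  (forall t, 0 < t -> h t = f t / (t + y)) -> integrable0y (fun t => t * h t).
Proof.
move=> y0 f0 fi hE; apply: (@eq_integrable0y _ (fun t => f t * (t / (t + y)))).
  by move=> t t0; rewrite hE// mulrCA.
apply: (ge0_le_integrable0y _ _ fi).
  apply: measurable_funM; first exact: measurable_integrable0y.
  by apply: measurable_funM => //; exact: measurable0y_inv.
move=> t t0; have ty : 0 < t + y by rewrite ltr_pwDl.
rewrite mulr_ge0 ?f0 ?divr_ge0 ?(ltW t0) ?(ltW ty)//= ler_piMr ?f0//.
by rewrite ler_pdivrMr// mul1r lerDl.
Qed.

(* Think of W z, normalised, as the posterior density of t given z.  Then dl z
   is the posterior mean of t, and (y + dl (incr_at z i))^-1 is the posterior mean
   of (y + t)^-1 for y = r + z i; u i and s i are the posterior means of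
   t / (t + y) and t ^+ 2 / (t + y). *)
Lemma posterior_shrinkage_le (R : realType) (m N n : nat) (r a : R)
    (W : ('I_N -> nat) -> R -> R) :
  let dl z := integral0y (fun t => t * W z t) / integral0y (W z) in
  let hb z := \sum_(i < N | (i < n)%N)
    (((z i)%:R + m%:R) * ((r + (z i)%:R) / (r + (z i)%:R + dl (incr_at z i)) ^+ 2)
     - 2 * ((z i)%:R / (r + (z i)%:R - 1 + dl z))) in
  let mvu z := \sum_(i < N | (i < n)%N)
    (((z i)%:R + m%:R) * ((r + (z i)%:R) / (r + (z i)%:R) ^+ 2)
     - 2 * ((z i)%:R / (r + (z i)%:R - 1))) in
  (3 <= m)%N -> m%:R <= r -> (0 < n <= N)%N ->
  (forall z t, 0 < t -> 0 < W z t) ->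
  (forall z, integrable0y (W z)) ->
  (forall z i t, 0 < t -> W (incr_at z i) t = W z t / (t + (r + (z i)%:R))) ->
  (forall z, integrable0y (fun t => t * W z t) ->
    integral0y (fun t => t * W z t *
      \sum_(i < N) ((z i)%:R + m%:R) * (t / (t + (r + (z i)%:R))))
    <= a * integral0y (fun t => t * W z t)) ->
  a <= n%:R * (m%:R - 2) ->
  forall z, hb z <= mvu z /\ ((forall i, z i = 0%N) -> hb z < mvu z).
Proof.
move=> dl hb mvu m3 mr n0N W0 Wi WS WL an z.
have [n0 nN] := andP n0N.
have m3R : 3 <= m%:R :> R by rewrite ler_nat.
pose y i := r + (z i)%:R; have y3 i : 3 <= y i.
  by rewrite /y; have := ler0n R (z i); lra.
have K0 : 0 < integral0y (W z) := integral0y_gt0 (W0 z) (Wi z).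
pose K := integral0y (W z).
have tWi z' i : integrable0y (fun t => t * W (incr_at z' i) t).
  apply: (@integrable0y_id_mul _ (r + (z' i)%:R) (W z')) => //.
  - by have := ler0n R (z' i); lra.
  - by move=> t t0; rewrite ltW// W0.
  - exact: WS.
pose u i := integral0y (fun t => t * W (incr_at z i) t) / K.
have Vi i : y i * integral0y (W (incr_at z i)) + integral0y (fun t => t * W (incr_at z i) t) = K.
  rewrite -integral0yZ// -integral0yD//; last exact: integrable0yZ.
  apply: eq_integral0y => t t0; rewrite WS// -/(y i); field.
  by rewrite gt_eqF//; have := y3 i; lra.
have V0 i : 0 < integral0y (W (incr_at z i)) := integral0y_gt0 (W0 _) (Wi _).
have U0 i : 0 < integral0y (fun t => t * W (incr_at z i) t).
  by apply: integral0y_gt0 => // t t0; rewrite mulr_gt0// W0.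
have u01 i : 0 < u i < 1.
  rewrite /u divr_gt0//= ltr_pdivrMr// mul1r -(Vi i) ltrDr mulr_gt0//.
  by have := y3 i; lra.
(* With [V] and [U] the integrals of [W] and [t * W] at the raised argument, [Vi] says
   [y * V + U = K]. Hence [y + U / V = K / V], while [1 - u = y * V / K]. *)
have hbE i : y i / (y i + dl (incr_at z i)) ^+ 2 = (y i)^-1 * (1 - u i) ^+ 2.
  have -> : 1 - u i = y i * integral0y (W (incr_at z i)) / K.
    by rewrite /u -{1}(divff (lt0r_neq0 K0)) -/K -mulrBl -(Vi i) addrK.
  rewrite /dl -(Vi i).
  have := V0 i; have := U0 i; have := y3 i.
  set V := integral0y (W _); set U := integral0y _ => yi U0' V0'.
  have yV : 0 < y i * V by rewrite mulr_gt0//; lra.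
  by field; rewrite !gt_eqF//; lra.
have {}hbE : hb z = \sum_(i < N | (i < n)%N)
    (((z i)%:R + m%:R) / y i * (1 - u i) ^+ 2
     - 2 * ((z i)%:R / (y i - 1 + dl z))).
  by apply: eq_bigr => i _; congr (_ - _); rewrite -/(y i) hbE mulrA.
have mvuE : mvu z = \sum_(i < N | (i < n)%N)
    (((z i)%:R + m%:R) / y i - 2 * ((z i)%:R / (y i - 1))).
  apply: eq_bigr => i _; congr (_ * _ - _).
  by rewrite -/(y i); field; rewrite gt_eqF//; have := y3 i; lra.
have strict : (forall i, z i = 0%N) -> hb z < mvu z.
  move=> z0; rewrite hbE mvuE.
  apply: ltr_sum => [|i ltin].
    apply/hasP; exists (Ordinal (leq_trans n0 nN)); rewrite ?mem_index_enum//=.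
  have /andP[ui0 ui1] := u01 i; rewrite z0 mul0r !mul0r mulr0 !subr0 add0r.
  rewrite -[ltRHS]mulr1 ltr_pM2l ?divr_gt0//; try by have := y3 i; lra.
  by rewrite exprn_ilt1//; lra.
split=> //.
have [/forallP z0|] := boolP [forall i, z i == 0%N].
  by apply/ltW/strict => i; exact/eqP.
rewrite negb_forall => /existsP[k zk].
have tz : integrable0y (fun t => t * W z t).
  by rewrite -(incr_at_decr zk); exact: tWi.
pose K1 := integral0y (fun t => t * W z t).
have K10 : 0 < K1 by apply: integral0y_gt0 => // t t0; rewrite mulr_gt0// W0.
pose d := dl z; have d0 : 0 < d by exact: divr_gt0.
have K1E : K1 = d * K by rewrite /d /dl divfK ?gt_eqF.
pose S i t := t * W z t * (t / (t + y i)).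
have Si i : integrable0y (S i).
  apply: (ge0_le_integrable0y _ _ tz).
    apply: measurable_funM; first exact: measurable_integrable0y.
    apply: measurable_funM => //; apply: measurable0y_inv.
    by have := y3 i; lra.
  move=> t t0; have := y3 i => yi; have tW : 0 <= t * W z t by rewrite mulr_ge0 ?(ltW t0)// ltW// W0.
  rewrite /S mulr_ge0//= ?ler_piMr// ?divr_ge0//; try lra.
  by rewrite ler_pdivrMr; lra.
pose s i := integral0y (S i) / K.
have s0 i : 0 <= s i.
  rewrite /s divr_ge0 ?(ltW K0)//; apply: integral0y_ge0 => t t0.
  have := y3 i => yi; rewrite /S !mulr_ge0 ?invr_ge0 ?(ltW t0)//; try lra.
  by rewrite ltW// W0.
rewrite hbE mvuE; apply: (@shrinkage_sum_le _ _ _ (fun i => (z i)%:R) s u _ _ _ a) => //.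
- lra.
- move=> i; rewrite -/(y i) -/d /u /s mulrA -mulrDl.
  rewrite -integral0yZ// -integral0yD//; last exact: integrable0yZ.
  rewrite /d /dl; congr (_ / _); apply: eq_integral0y => t t0.
  rewrite WS// -/(y i) /S; field.
  by rewrite gt_eqF//; have := y3 i; lra.
- (* Jensen: the concave t / (t + y i) lies below its tangent at t = d. *)
  move=> i; have /andP[/ltW -> _] /= := u01 i.
  have := y3 i; rewrite -/d -/(y i) => yi.
  rewrite ler_pdivrMr//.
  have -> : d / (d + y i) * K =
      (d / (d + y i) - y i * d / (d + y i) ^+ 2) * K + y i / (d + y i) ^+ 2 * K1.
    by rewrite K1E; field; rewrite gt_eqF//; lra.
  rewrite -!integral0yZ// -integral0yD//; try exact: integrable0yZ.
  apply: le_integral0y => //; first by apply: integrable0yD; exact: integrable0yZ.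
  move=> t t0; rewrite WS//.
  have -> : t * (W z t / (t + (r + (z i)%:R))) = t / (t + y i) * W z t by rewrite mulrA mulrAC.
  rewrite -subr_ge0.
  rewrite (_ : _ - _ = y i * (t - d) ^+ 2 / ((d + y i) ^+ 2 * (t + y i)) * W z t).
    have yi0 : 0 <= y i by lra.
    have ty0 : 0 <= t + y i by lra.
    rewrite mulr_ge0 ?(ltW (W0 _ _ t0))// divr_ge0//; apply: mulr_ge0 => //.
    - exact: sqr_ge0.
    - exact: sqr_ge0.
  by field; rewrite !gt_eqF//; lra.
(* Already under the integral, [(z + m) / (t + r + z)] increases in [z], because
   [t + r - m >= 0]. *)
- move=> i j; rewrite ler_nat => zij; rewrite /s !mulrA ler_wpM2r ?invr_ge0 ?(ltW K0)//.
  rewrite -!integral0yZ//; apply: le_integral0y; try exact: integrable0yZ.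
  move=> t t0; rewrite /S ![_ * (t * W z t * _)]mulrCA ler_wpM2l//.
    by rewrite mulr_ge0 ?(ltW t0)// ltW// W0.
  rewrite !mulrA [_ * t]mulrC [(_ + _) * t]mulrC -!mulrA ler_pM2l//.
  have yi := y3 i; have yj := y3 j.
  have tyi : 0 < t + y i by lra.
  have tyj : 0 < t + y j by lra.
  rewrite ler_pdivrMr// mulrAC ler_pdivlMr//.
  have zijR : (z i)%:R <= (z j)%:R :> R by rewrite ler_nat.
  rewrite -subr_ge0 /y.
  have -> : ((z j)%:R + m%:R) * (t + (r + (z i)%:R)) - ((z i)%:R + m%:R) * (t + (r + (z j)%:R))
    = ((z j)%:R - (z i)%:R) * (t + (r - m%:R)) by ring.
  by rewrite mulr_ge0//; lra.
(* The integration by parts bound concerns all [N] columns; the terms beyond the first [n] are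
   nonnegative and may be added. *)
apply: (@le_trans _ _ (\sum_i ((z i)%:R + m%:R) * s i)).
  rewrite [leRHS](bigID (fun i : 'I_N => (i < n)%N))/= lerDl sumr_ge0// => i _.
  by rewrite mulr_ge0.
rewrite -/d /d /dl mulrA -[X in _ / X]/K.
under eq_bigr do rewrite /s mulrA.
rewrite -mulr_suml ler_pM2r ?invr_gt0//.
apply: le_trans (WL _ tz).
rewrite le_eqVlt; apply/orP; left; apply/eqP.
under eq_bigr do rewrite -integral0yZ//.
rewrite -integral0y_sum; last by move=> i; exact: integrable0yZ.
apply: eq_integral0y => t t0; rewrite mulr_sumr; apply: eq_bigr => i _.
by rewrite /S mulrCA.
Qed.

(** * The integrand of the hierarchical Bayes estimator *)

Lemma Gamma_ratio (R : realType) (x : R) (n : nat) : 0 < x ->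
  Gamma x / Gamma (x + n%:R) = \prod_(0 <= k < n) (x + k%:R)^-1.
Proof.
move=> x0; rewrite Gamma_addn// invfM mulrCA divff ?mulr1; last first.
  by rewrite gt_eqF// Gamma_gt0.
by rewrite big_mkord prodfV.
Qed.

(* The integrand of Kint, with the quotients of Gamma functions evaluated. *)
Definition hb_weight (R : realType) (m N : nat) (r alpha beta : R) (g : R -> R)
    (z : 'I_N -> nat) (t : R) : R :=
  t `^ (alpha - 1) * (expR (- beta * t) * g t) *
  \prod_(i < N) \prod_(0 <= k < z i + m) (t + (r - m%:R + k%:R))^-1.

Lemma prod_incr_at (R : comRingType) (N m : nat) (z : 'I_N -> nat) (j : 'I_N)
    (F : nat -> R) :
  \prod_(i < N) \prod_(0 <= k < incr_at z j i + m) F k =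
  (\prod_(i < N) \prod_(0 <= k < z i + m) F k) * F (z j + m)%N.
Proof.
rewrite (bigD1 j)//= [in RHS](bigD1 j)//= {1}/incr_at eqxx addn1 addSn.
rewrite big_nat_recr//= -!mulrA; congr (_ * _); rewrite mulrC; congr (_ * _).
by apply: eq_bigr => i /negPf ij; rewrite /incr_at ij addn0.
Qed.

Section hb_weight.
Context {R : realType} {m N : nat} {r alpha beta : R} {g : R -> R}.
Let W : ('I_N -> nat) -> R -> R := hb_weight m r alpha beta g.

(** The single new factor has index [k = z j + m], where [r - m + k = r + z j]. *)
Lemma hb_weight_incr (z : 'I_N -> nat) (j : 'I_N) (t : R) :
  W (incr_at z j) t = W z t / (t + (r + (z j)%:R)).
Proof.
rewrite /W /hb_weight -[RHS]mulrA; congr (_ * _).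
rewrite (prod_incr_at _ _ _ (fun k => (t + (r - m%:R + k%:R))^-1)).
congr (_ * (_ + _)^-1); rewrite natrD; ring.
Qed.

Lemma hb_weight_gt0 (z : 'I_N -> nat) (t : R) : m%:R <= r ->
  (forall t, 0 < t -> 0 < g t) -> 0 < t -> 0 < W z t.
Proof.
move=> mr g0 t0; rewrite !mulr_gt0 ?powR_gt0 ?expR_gt0 ?g0//.
apply: prodr_gt0 => i _; apply: prodr_gt0 => k _.
by rewrite invr_gt0 ltr_pwDl// addr_ge0// subr_ge0.
Qed.

Lemma measurable_hb_weight (z : 'I_N -> nat) : m%:R <= r ->
  measurable0y g -> measurable0y (W z).
Proof.
move=> mr mg; apply: measurable_funM; last first.
  apply: measurable_prod => i _; apply: measurable_prod => k _.
  by apply: measurable0y_inv; rewrite addr_ge0// subr_ge0.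
apply: measurable_funM.
  by apply: measurable_funTS; exact: measurable_powR.
apply: measurable_funM => //.
by apply: (@measurableT_comp _ _ _ _ _ _ expR) => //.
Qed.

(** The factors beyond those present at [z = 0] have index [k >= m >= 1], hence a denominator of at
    least 1. Integrability for all [z] thus reduces to [z = 0]. *)
Lemma le_hb_weight0 (z : 'I_N -> nat) (t : R) : (0 < m)%N -> m%:R <= r ->
  (forall t, 0 < t -> 0 < g t) -> 0 < t -> W z t <= W (fun=> 0%N) t.
Proof.
move=> m0 mr g0 t0; rewrite /W /hb_weight ler_wpM2l//.
  by rewrite !mulr_ge0 ?powR_ge0 ?expR_ge0 ?(ltW (g0 _ t0)).
apply: ler_prod => i _; apply/andP; split.
  apply: prodr_ge0 => k _; rewrite invr_ge0 addr_ge0 ?(ltW t0)//.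
  by rewrite addr_ge0// subr_ge0.
rewrite (@big_cat_nat _ _ _ m)//=; last exact: leq_addl.
rewrite add0n ler_piMr//.
  apply: prodr_ge0 => k _; rewrite invr_ge0 addr_ge0 ?(ltW t0)//.
  by rewrite addr_ge0// subr_ge0.
rewrite big_nat; apply: prodr_ile1 => k /andP[mk _].
have k1 : 1 <= k%:R :> R by rewrite ler1n (leq_trans m0).
have a1 : 1 <= t + (r - m%:R + k%:R) by lra.
by rewrite invr_ge0 (le_trans ler01 a1)/= invf_le1// (lt_le_trans ltr01 a1).
Qed.

End hb_weight.

Lemma smooth_pos_measurable (R : realType) (g : R -> R) :
  smooth_pos g -> measurable0y g.
Proof.
move=> sg; apply: open_continuous_measurable_fun => //.
move=> t /[!inE]/=; rewrite in_itv/= andbT => t0.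
by apply/differentiable_continuous/derivable1_diffP; exact: (sg 0%N).
Qed.

Lemma ge0_le_integral_lty (R : realType) (A : set R) (f h : R -> R) :
  measurable A -> A `<=` `]0, +oo[%classic ->
  measurable0y f -> measurable0y h ->
  (forall t, A t -> 0 <= f t <= h t) ->
  (\int[@lebesgue_measure R]_(t in A) (h t)%:E < +oo)%E ->
  (\int[@lebesgue_measure R]_(t in A) (f t)%:E < +oo)%E.
Proof.
move=> mA A0 mf mh fh; apply: le_lt_trans; apply: ge0_le_integral => //=.
- by move=> t At; rewrite lee_fin; have /andP[] := fh _ At.
- by apply/measurable_EFinP; apply: measurable_funS mf.
- by apply/measurable_EFinP; apply: measurable_funS mh.
- by move=> t At; rewrite lee_fin; have /andP[] := fh _ At.
Qed.

Section hb_weight_integrable.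
Context {R : realType} {m N : nat} {r alpha beta : R} {g : R -> R}.
Hypotheses (m0 : (0 < m)%N) (alpha0 : 0 < alpha) (beta0 : 0 <= beta).
Hypotheses (g0 : forall t, 0 < t -> 0 < g t)
  (gM : exists M, forall t, 0 < t -> g t <= M) (sg : smooth_pos g).
Hypothesis A12 : condA1 m N r alpha beta g \/ condA2 m N r alpha beta g.
Let W : ('I_N -> nat) -> R -> R := hb_weight m r alpha beta g.

Lemma le_m_r : m%:R <= r.
Proof. by case: A12 => [[/ltW]|[->]]. Qed.

Lemma integrable_hb_weight (z : 'I_N -> nat) : integrable0y (W z).
Proof.
have mr := le_m_r; have mg := smooth_pos_measurable sg.
have Wz0 z' t : 0 < t -> 0 <= W z' t by move=> t0; rewrite ltW// hb_weight_gt0.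
suff W0 : integrable0y (W (fun=> 0%N)).
  apply: (ge0_le_integrable0y _ _ W0); first exact: measurable_hb_weight.
  by move=> t t0; rewrite Wz0//= le_hb_weight0.
have mp (b : R) : measurable0y (fun t => t `^ b * expR (- beta * t) * g t).
  apply: measurable_funM => //; apply: measurable_funM.
    by apply: measurable_funTS; exact: measurable_powR.
  by apply: (@measurableT_comp _ _ _ _ _ _ expR) => //.
have h0 t : 0 < t -> 0 <= expR (- beta * t) * g t.
  by move=> t0; rewrite mulr_ge0 ?expR_ge0 ?ltW ?g0.
have pN (t : R) (n : nat) : 0 < t -> t `^ (alpha - 1) * t^-1 ^+ n = t `^ (alpha - n%:R - 1).
  move=> t0; rewrite exprVn -powR_invn ?(ltW t0)// -powRD ?(gt_eqF t0) ?implybT//.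
  by congr (_ `^ _); ring.
have fac0 (t : R) k : 0 < t -> 0 < t + (r - m%:R + k%:R).
  by move=> t0; rewrite ltr_pwDl// addr_ge0// subr_ge0.
have I1 : (\int[@lebesgue_measure R]_(t in `[1%R, +oo[)
    (t `^ (alpha - (N * m)%N%:R - 1) * expR (- beta * t) * g t)%:E < +oo)%E.
  by case: A12 => [[]|[]].
apply: integrable0yP => //.
- exact: measurable_hb_weight.
- by move=> t; exact: Wz0.
- case: A12 => [[mr' _]|[rm I0 _]].
  + have [M gM'] := gM.
    pose C := \prod_(i < N) \prod_(0 <= k < 0 + m) (r - m%:R)^-1.
    have C0 : 0 <= C.
      by apply: prodr_ge0 => i _; apply: prodr_ge0 => k _; rewrite invr_ge0 subr_ge0.
    have M0 : 0 <= M by apply: le_trans (gM' _ ltr01); rewrite ltW ?g0.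
    apply: (@ge0_le_integral_lty _ _ _ (fun t => M * C * t `^ (alpha - 1))) => //.
    * by move=> t /=; rewrite !in_itv/= andbT => /andP[].
    * exact: measurable_hb_weight.
    * apply: measurable_funM => //.
      by apply: measurable_funTS; exact: measurable_powR.
    * move=> t /=; rewrite in_itv/= => /andP[t0 _]; rewrite Wz0//= /W /hb_weight.
      rewrite -[leLHS]mulrA [leRHS]mulrC ler_wpM2l ?powR_ge0//.
      apply: ler_pM => //.
      - exact: h0.
      - by apply: prodr_ge0 => i _; apply: prodr_ge0 => k _; rewrite invr_ge0 ltW ?fac0.
      - rewrite -[leRHS]mul1r; apply: ler_pM (gM' _ t0); rewrite ?expR_ge0 ?(ltW (g0 t0))//.
        by rewrite expR_le1 mulNr oppr_le0 mulr_ge0// ltW.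
      - apply: ler_prod => i _; apply/andP; split.
          by apply: prodr_ge0 => k _; rewrite invr_ge0 ltW ?fac0.
        apply: ler_prod => k _; rewrite invr_ge0 ltW ?fac0//=.
        have rm : 0 < r - m%:R by rewrite subr_gt0.
        rewrite lef_pV2 ?posrE ?fac0//.
        by rewrite addrCA lerDl addr_ge0 ?(ltW t0).
    * under eq_integral do rewrite EFinM.
      rewrite ge0_integralZl//=.
      - by rewrite lte_mul_pinfty ?lee_fin ?mulr_ge0// integral_powR_0_1.
      - apply/measurable_EFinP/measurable_funTS; exact: measurable_powR.
      - by move=> t _; rewrite lee_fin powR_ge0.
      - by rewrite lee_fin mulr_ge0.
  + apply: (ge0_le_integral_lty _ _ _ _ _ I0) => //.
    * by move=> t /=; rewrite !in_itv/= andbT => /andP[].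
    * exact: measurable_hb_weight.
    * move=> t /=; rewrite in_itv/= => /andP[t0 _]; rewrite Wz0//= /W /hb_weight.
      rewrite -pN// -[leRHS]mulrA [leRHS]mulrAC ler_wpM2l ?(mulr_ge0 (powR_ge0 _ _) (h0 _ t0))//.
      rewrite -[X in _ ^+ X]card_ord -prodr_const.
      apply: ler_prod => i _; apply/andP; split.
        by apply: prodr_ge0 => k _; rewrite invr_ge0 ltW ?fac0.
      rewrite add0n big_ltn// rm subrr !addr0 ler_piMr ?invr_ge0 ?(ltW t0)//.
      rewrite big_nat; apply: prodr_ile1 => k /andP[k1 _].
      have k1R : 1 <= k%:R :> R by rewrite ler1n.
      have a1 : 1 <= t + (0 + k%:R) by lra.
      by rewrite invr_ge0 (le_trans ler01 a1)/= invf_le1// (lt_le_trans ltr01 a1).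
- apply: (ge0_le_integral_lty _ _ _ _ _ I1) => //.
  + by move=> t /=; rewrite !in_itv/= !andbT; exact: lt_le_trans.
  + exact: measurable_hb_weight.
  + move=> t /=; rewrite in_itv/= andbT => t1.
    have t0 : 0 < t by exact: lt_le_trans t1.
    rewrite Wz0//= /W /hb_weight -pN// -[leRHS]mulrA [leRHS]mulrAC.
    rewrite ler_wpM2l ?(mulr_ge0 (powR_ge0 _ _) (h0 _ t0))//.
    rewrite mulnC exprM -[X in _ ^+ X]card_ord -prodr_const.
    apply: ler_prod => i _; apply/andP; split.
      by apply: prodr_ge0 => k _; rewrite invr_ge0 ltW ?fac0.
    rewrite add0n -[X in _ ^+ X]card_ord -prodr_const big_mkord.
    apply: ler_prod => k _; rewrite invr_ge0 ltW ?fac0//=.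
    by rewrite lef_pV2 ?posrE ?fac0// lerDl addr_ge0// subr_ge0.
Qed.

End hb_weight_integrable.

Section hb_delta.
Context {R : realType} {m N : nat} {r alpha beta : R} {g : R -> R}.
Hypotheses (m0 : (0 < m)%N) (alpha0 : 0 < alpha) (beta0 : 0 <= beta).
Hypotheses (g0 : forall t, 0 < t -> 0 < g t)
  (gM : exists M, forall t, 0 < t -> g t <= M) (sg : smooth_pos g).
Hypothesis A12 : condA1 m N r alpha beta g \/ condA2 m N r alpha beta g.
Hypothesis gni : {in `]0, +oo[ &, nonincreasing_fun g}.
Let W : ('I_N -> nat) -> R -> R := hb_weight m r alpha beta g.

Let mr : m%:R <= r := le_m_r A12.
Let W0 (z : 'I_N -> nat) t : 0 < t -> 0 < W z t := hb_weight_gt0 z mr g0.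
Let Wi (z : 'I_N -> nat) : integrable0y (W z) :=
  integrable_hb_weight m0 alpha0 beta0 g0 gM sg A12 z.

Lemma integrable_id_mul_hb_weight (z : 'I_N -> nat) (k : 'I_N) :
  z k != 0%N -> integrable0y (fun t => t * W z t).
Proof.
move=> zk; rewrite -(incr_at_decr zk).
pose z' i := (z i - (i == k))%N.
apply: (@integrable0y_id_mul _ (r + (z' k)%:R) (W z')) => //.
- by rewrite addr_ge0// (le_trans _ mr).
- by move=> t t0; exact/ltW/W0.
- by move=> t t0; exact: hb_weight_incr.
Qed.

(** Apply [integral_log_derivative_le] with [c = alpha], the nonincreasing
    [h t = expR (- beta * t) * g t], and [s] the list of all shifts [r - m + k]. Column [i]
    contributes [z i + m] terms [t / (t + (r - m + k))], each at least [t / (t + (r + z i))] since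
    [k < z i + m]. *)
Lemma hb_weight_log_derivative (z : 'I_N -> nat) :
  integrable0y (fun t => t * W z t) ->
  integral0y (fun t => t * W z t *
    \sum_(i < N) ((z i)%:R + m%:R) * (t / (t + (r + (z i)%:R)))) <=
  (alpha + 1) * integral0y (fun t => t * W z t).
Proof.
move=> tWi.
pose s : seq R := [seq r - m%:R + k%:R | i : 'I_N <- index_enum 'I_N, k <- index_iota 0 (z i + m)].
pose h t := expR (- beta * t) * g t.
have s0 : all (fun a => 0 <= a) s.
  by apply/allP => _ /allpairsPdep[i [k [_ _ ->]]]; rewrite addr_ge0// subr_ge0.
have fE t : 0 < t -> t * W z t = t `^ alpha * h t * \prod_(a <- s) (t + a)^-1.
  by move=> t0; rewrite /s big_allpairs_dep/= /W /hb_weight !mulrA mulr_powRB1// ltW.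
have h0 t : 0 < t -> 0 <= h t by move=> t0; rewrite mulr_ge0 ?expR_ge0// ltW// g0.
have hni : {in `]0, +oo[ &, nonincreasing_fun h}.
  move=> x y; rewrite !in_itv/= !andbT => x0 y0 xy.
  apply: ler_pM; rewrite ?expR_ge0 ?(ltW (g0 _))//.
    by rewrite ler_expR !mulNr lerN2 ler_wpM2l.
  by apply: gni; rewrite ?in_itv/= ?x0 ?y0.
have fi : integrable0y (fun t => t `^ alpha * h t * \prod_(a <- s) (t + a)^-1).
  exact: eq_integrable0y tWi.
have := integral_log_derivative_le (ltW alpha0) s0 h0 hni fi.
rewrite -(eq_integral0y fE); apply: le_trans.
have f0 t : 0 < t -> 0 <= t `^ alpha * h t * \prod_(a <- s) (t + a)^-1.
  by move=> t0; rewrite -fE// mulr_ge0 ?(ltW t0)// ltW// W0.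
have iT := integrable0y_mul_sum s0 f0 fi.
have le t : 0 < t -> t * W z t * \sum_(i < N) ((z i)%:R + m%:R) * (t / (t + (r + (z i)%:R))) <=
    t `^ alpha * h t * \prod_(a <- s) (t + a)^-1 * \sum_(a <- s) t / (t + a).
  move=> t0; rewrite fE// ler_wpM2l ?f0// /s big_allpairs_dep/=.
  apply: ler_sum => i _; apply: (@le_trans _ _ (\sum_(0 <= k < z i + m) t / (t + (r + (z i)%:R)))).
    by rewrite sumr_const_nat subn0 -natrD mulr_natl.
  apply: ler_sum_nat => k /andP[_ kzm]; rewrite ler_pM2l//.
  have kR : k%:R <= (z i)%:R + m%:R :> R by rewrite -natrD ler_nat ltnW.
  have tk : 0 < t + (r - m%:R + k%:R) by rewrite ltr_pwDl// addr_ge0// subr_ge0.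
  by rewrite lef_pV2 ?posrE//; lra.
apply: le_integral0y => //.
apply: (ge0_le_integrable0y _ _ iT).
  apply: measurable_funM; first exact: measurable_integrable0y.
  apply: measurable_sum => i; apply: measurable_funM => //.
  apply: measurable_funM => //; apply: measurable0y_inv.
  by rewrite addr_ge0// (le_trans _ mr).
move=> t t0; rewrite le// andbT mulr_ge0//; first by rewrite fE// f0.
apply: sumr_ge0 => i _; rewrite mulr_ge0// divr_ge0 ?(ltW t0)//.
by rewrite !addr_ge0 ?(ltW t0)// (le_trans _ mr).
Qed.

(** The integrability hypothesis makes the numerator finite, so the extended quotient becomes the
    real posterior mean of [t]. *)
Lemma delta_hbE (z : 'I_N -> nat) : integrable0y (fun t => t * W z t) ->
  delta m r alpha beta g z =
  (integral0y (fun t => t * W z t) / integral0y (W z))%:E.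
Proof.
move=> tWi.
have ratio t : 0 < t ->
    \prod_(i < N) (Gamma (t + (r - m%:R)) / Gamma (t + (r - m%:R) + ((z i)%:R + m%:R))) =
    \prod_(i < N) \prod_(0 <= k < z i + m) (t + (r - m%:R + k%:R))^-1.
  move=> t0; apply: eq_bigr => i _; rewrite -natrD Gamma_ratio; last first.
    by rewrite ltr_pwDl// subr_ge0.
  by apply: eq_bigr => k _; rewrite -addrA.
have K0 : Kint alpha beta g (r - m%:R) (fun i => (z i)%:R + m%:R) = (integral0y (W z))%:E.
  rewrite /integral0y /Rintegral fineK; last exact: integrable_fin_num (Wi z).
  apply: eq_integral => t /[!inE]/=; rewrite in_itv/= andbT => t0.
  by rewrite ratio// /W /hb_weight !mulrA.
have K1 : Kint (alpha + 1) beta g (r - m%:R) (fun i => (z i)%:R + m%:R) =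
    (integral0y (fun t => t * W z t))%:E.
  rewrite /integral0y /Rintegral fineK; last exact: integrable_fin_num tWi.
  apply: eq_integral => t /[!inE]/=; rewrite in_itv/= andbT => t0.
  by rewrite ratio// /W /hb_weight addrK !mulrA mulr_powRB1// ltW.
by rewrite /delta K0 K1 inver gt_eqF//; apply: integral0y_gt0 (Wi z) => t; exact: W0.
Qed.

End hb_delta.

(** * Expectations under the negative multinomial model *)

Lemma measurable_fun_discrete d (T : measurableType d) d' (U : measurableType d')
    (E : countType) (Y : T -> E) (f : E -> U) :
  (forall x, measurable [set w | Y w = x]) -> measurable_fun setT (f \o Y).
Proof.
move=> mY _ B _; rewrite setTI.
have -> : (f \o Y) @^-1` B = \bigcup_(x in [set x | B (f x)]) [set w | Y w = x].
  by apply/seteqP; split=> [w Bw|w [x Bx /= ->//]]; exists (Y w).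
rewrite bigcup_mkcond; apply: countable_bigcupT_measurable => // x.
by case: ifPn => _ //; exact: measurable0.
Qed.

(** The fibres of [Y], numbered by [pickle], partition the space into countably many pieces on which
    the integrand is constant; numbers that encode no value have an empty fibre. *)
Lemma ge0_integral_discrete (R : realType) d (T : measurableType d)
    (P : {measure set T -> \bar R}) (E : countType) (Y : T -> E) (f : E -> R) :
  (forall x, measurable [set w | Y w = x]) -> (forall x, 0 <= f x) ->
  (\int[P]_w (f (Y w))%:E = \esum_(x in [set: E]) ((f x)%:E * P [set w | Y w = x]))%E.
Proof.
move=> mY f0.
pose F n := [set w | pickle (Y w) = n].
have mF n : measurable (F n).
  have := measurable_fun_discrete (fun x => pickle x) mY.
  move=> /(_ measurableT [set n]); rewrite setTI; apply.
  by [].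
have FT : \bigcup_n F n = setT by apply/seteqP; split=> // w _; exists (pickle (Y w)).
have mfY : measurable_fun setT (fun w => (f (Y w))%:E).
  by apply/measurable_EFinP; exact: measurable_fun_discrete.
have tF : trivIset setT F by move=> i j _ _ [w [/= <- <-]].
rewrite -{1}FT ge0_integral_bigcup//= ?FT//; last first.
  by move=> w _; rewrite lee_fin.
rewrite nneseries_esumT; last by move=> n; apply: integral_ge0 => w _; rewrite lee_fin.
rewrite (esumID (range (@pickle E)))/=; last first.
  by move=> n _; apply: integral_ge0 => w _; rewrite lee_fin.
rewrite [X in (_ + X)%E]esum1 ?adde0; last first.
  move=> n [_ nr]; rewrite (_ : F n = set0) ?integral_set0//.
  by apply/seteqP; split=> // w wn; apply: nr; exists (Y w).
rewrite setTI (@reindex_esum _ _ _ setT _ (@pickle E)); last first.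
  by split=> //; move=> x y _ _; exact: (pcan_inj pickleK).
apply: eq_esum => x _.
have -> : F (pickle x) = [set w | Y w = x].
  by apply/seteqP; split=> w /=; [move/(pcan_inj pickleK)|rewrite /F/= => ->].
rewrite (@eq_integral _ _ _ _ _ (cst (f x)%:E)); last by move=> w /[!inE] /= ->.
by rewrite integral_cst.
Qed.

Definition NM_joint (R : realType) (m N : nat) (r : R) (p : 'M[R]_(m, N))
    (x : 'M[nat]_(m, N)) : R :=
  \prod_nu NM_pmf r (col nu p) (col nu x).

Section model.
Context {R : realType} {d : measure_display} {T : measurableType d} {m N : nat}
  {r : R} {P : 'M[R]_(m, N) -> probability T R} {X : T -> 'M[nat]_(m, N)}.
Hypothesis model : NM_model r P X.

Lemma measurable_model (x : 'M[nat]_(m, N)) : measurable [set w | X w = x].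
Proof.
have -> : [set w | X w = x] =
    \bigcap_(ij in [set: 'I_m * 'I_N]) [set w | X w ij.1 ij.2 = x ij.1 ij.2].
  apply/seteqP; split=> w /= Xw; first by move=> ij _ /=; rewrite Xw.
  by apply/matrixP => i j; exact: (Xw (i, j)).
apply: fin_bigcap_measurable => // -[i j] _ /=.
have [mX _] := model; have := mX i j measurableT [set x i j].
by rewrite setTI; apply.
Qed.

Lemma model_pmf (p : 'M[R]_(m, N)) (x : 'M[nat]_(m, N)) : D_prod R m N p ->
  P p [set w | X w = x] = (NM_joint r p x)%:E.
Proof.
move=> Dp; have [_ /(_ p Dp) [indep pmf]] := model.
(* Independence of all columns, tested on singletons, gives the joint mass function. *)
have := indep [set: 'I_N]%SET (fun nu => [set col nu x]).
have -> : [set w | forall i, i \in [set: 'I_N]%SET -> [set col i x] (col i (X w))]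
    = [set w | X w = x].
  apply/seteqP; split=> w /= Xw; last by move=> i _; rewrite Xw.
  apply/matrixP => i j; have := Xw j; rewrite finset.in_setT => /(_ isT)/matrixP/(_ i 0).
  by rewrite !mxE.
move=> ->; rewrite /NM_joint -prodEFin; apply: eq_big => [i|i _]; first by rewrite finset.in_setT.
exact: pmf.
Qed.

Lemma ge0_integral_model (p : 'M[R]_(m, N)) (f : 'M[nat]_(m, N) -> R) :
  D_prod R m N p -> (forall x, 0 <= f x) ->
  (\int[P p]_w (f (X w))%:E = \esum_(x in [set: 'M[nat]_(m, N)]) (f x * NM_joint r p x)%:E)%E.
Proof.
move=> Dp f0; rewrite ge0_integral_discrete//; last exact: measurable_model.
by apply: eq_esum => x _; rewrite EFinM; congr (_ * _)%E; exact: model_pmf.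
Qed.

End model.

(** * Shifting one entry of the data and the unbiased risk estimate *)

Definition shift_at (m N : nat) (x : 'M[nat]_(m, N)) (i : 'I_m) (j : 'I_N) : 'M[nat]_(m, N) :=
  \matrix_(k, l) (x k l + ((k == i) && (l == j)))%N.

Lemma col_total_shift (m N : nat) (x : 'M[nat]_(m, N)) (i : 'I_m) (j : 'I_N) :
  col_total (shift_at x i j) = incr_at (col_total x) j.
Proof.
apply/funext => l; rewrite /col_total /incr_at.
rewrite (eq_bigr (fun k => x k l + ((k == i) && (l == j)))%N); last by move=> k _; rewrite mxE.
rewrite big_split/=; congr (_ + _)%N.
rewrite (bigD1 i)//= eqxx big1 ?addn0// => k /negPf ->//.
Qed.

Lemma NM_pmf_gt0 (R : realType) (m : nat) (r : R) (q : 'cV[R]_m) (x : 'cV[nat]_m) :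
  0 < r -> D_set q -> 0 < NM_pmf r q x.
Proof.
move=> r0 [q0 q1]; rewrite !mulr_gt0 ?powR_gt0 ?invr_gt0 ?subr_gt0//.
- by rewrite Gamma_gt0// ltr_wpDr.
- by rewrite mulr_gt0 ?Gamma_gt0//; apply: prodr_gt0 => i _; rewrite ltr0n fact_gt0.
- by apply: prodr_gt0 => i _; rewrite exprn_gt0.
Qed.

(** The Gamma recursion, one factorial factor and one power of [q i] account for the ratio.
    Describing [y] entrywise lets the lemma apply directly to a column of a shifted matrix. *)
Lemma NM_pmf_incr (R : realType) (m : nat) (r : R) (q : 'cV[R]_m)
    (x y : 'cV[nat]_m) (i : 'I_m) : 0 < r ->
  (forall k, y k ord0 = (x k ord0 + (k == i))%N) ->
  NM_pmf r q y = NM_pmf r q x *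
    ((r + (\sum_k x k ord0)%N%:R) / (x i ord0).+1%:R) * q i 0.
Proof.
move=> r0 yE.
have yi : y i ord0 = (x i ord0).+1 by rewrite yE eqxx addn1.
have yk k : k != i -> y k ord0 = x k ord0 by move=> /negPf ki; rewrite yE ki addn0.
have S : (\sum_k y k ord0 = (\sum_k x k ord0).+1)%N.
  rewrite (bigD1 i)//= [in RHS](bigD1 i)//= yi addSn; congr (_ + _).+1.
  by apply: eq_bigr => k /yk.
have F : \prod_k (y k ord0)`!%:R = (x i ord0).+1%:R * \prod_k (x k ord0)`!%:R :> R.
  rewrite (bigD1 i)//= [in RHS](bigD1 i)//= yi factS natrM -mulrA; congr (_ * (_ * _)).
  by apply: eq_bigr => k /yk ->.
have Q : \prod_k q k 0 ^+ y k 0 = q i 0 * \prod_k q k 0 ^+ x k 0.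
  rewrite (bigD1 i)//= [in RHS](bigD1 i)//= yi exprS -mulrA; congr (_ * (_ * _)).
  by apply: eq_bigr => k /yk ->.
rewrite /NM_pmf S F Q -natr1 addrA Gamma_add1 ?ltr_wpDr//.
have F0 : \prod_k (x k ord0)`!%:R != 0 :> R.
  by rewrite gt_eqF//; apply: prodr_gt0 => k _; rewrite ltr0n fact_gt0.
have G0 : Gamma r != 0 by rewrite gt_eqF// Gamma_gt0.
have : (x i ord0).+1%:R != 0 :> R by rewrite pnatr_eq0.
move: (_.+1%:R) => c c0.
by field; rewrite F0 G0 c0.
Qed.

Section Rintegral_sum.
Context d {T : measurableType d} {R : realType} (mu : {measure set T -> \bar R}).

Lemma integrable_sumR (I : Type) (l : seq I) (Q : pred I) (f : I -> T -> R) :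
  (forall i, Q i -> mu.-integrable setT (EFin \o f i)) ->
  mu.-integrable setT (EFin \o (fun t => \sum_(i <- l | Q i) f i t)).
Proof.
move=> fi; have := integrable_sum measurableT l fi; apply: eq_integrable => // t _.
by rewrite /= sumEFin.
Qed.

Lemma Rintegral_sum (I : Type) (l : seq I) (Q : pred I) (f : I -> T -> R) :
  (forall i, Q i -> mu.-integrable setT (EFin \o f i)) ->
  \int[mu]_t (\sum_(i <- l | Q i) f i t) = \sum_(i <- l | Q i) \int[mu]_t f i t.
Proof.
move=> fi; elim: l => [|i l IH].
  transitivity (\int[mu]_t (cst 0 t)).
    by apply: eq_Rintegral => t _; rewrite big_nil.
  by rewrite Rintegral_cst// mul0r big_nil.
rewrite big_cons -IH; case: ifPn => Qi.
  rewrite -RintegralD//; [|exact: fi|exact: integrable_sumR].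
  by apply: eq_Rintegral => t _; rewrite big_cons Qi.
by apply: eq_Rintegral => t _; rewrite big_cons (negPf Qi).
Qed.

End Rintegral_sum.

(* Up to a constant, an unbiased estimator of the risk that is free of p. *)
Definition unbiased_risk (R : realType) (m N n : nat) (r : R)
    (dh : 'M[nat]_(m, N) -> 'M[R]_(m, N)) (x : 'M[nat]_(m, N)) : R :=
  \sum_(j < N | (j < n)%N) \sum_(i < m)
    (dh (shift_at x i j) i j ^+ 2 * ((r + (col_total x j)%:R) / (x i j).+1%:R)
     - 2 * dh x i j).

Section risk.
Context {R : realType} {d : measure_display} {T : measurableType d} {m N : nat}
  {r : R} {P : 'M[R]_(m, N) -> probability T R} {X : T -> 'M[nat]_(m, N)}.
Hypotheses (r0 : 0 < r) (model : NM_model r P X).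

Lemma NM_joint_shift (p : 'M[R]_(m, N)) (x : 'M[nat]_(m, N)) i j :
  NM_joint r p (shift_at x i j) = NM_joint r p x *
    ((r + (col_total x j)%:R) / (x i j).+1%:R) * p i j.
Proof.
rewrite /NM_joint (bigD1 j)//= [in RHS](bigD1 j)//=.
rewrite (@NM_pmf_incr _ _ _ _ (col j x) _ i)//; last first.
  by move=> k; rewrite !mxE eqxx andbT.
rewrite !mxE (eq_bigr (fun k => x k j)); last by move=> k _; rewrite !mxE.
rewrite -/(col_total x j).
rewrite (eq_bigr (fun l => NM_pmf r (col l p) (col l x))).
  by rewrite mulrAC [X in X * p i j]mulrAC.
move=> l /negPf lj; congr NM_pmf; apply/matrixP => k l'.
by rewrite !mxE lj andbF addn0.
Qed.

Lemma NM_joint_gt0 (p : 'M[R]_(m, N)) (x : 'M[nat]_(m, N)) :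
  D_prod R m N p -> 0 < NM_joint r p x.
Proof. by move=> Dp; apply: prodr_gt0 => j _; exact: NM_pmf_gt0. Qed.

Lemma D_prod_gt0 (p : 'M[R]_(m, N)) i j : D_prod R m N p -> 0 < p i j.
Proof. by move=> /(_ j)[/(_ i)]; rewrite mxE. Qed.

(* The shift x_ij |-> x_ij + 1 multiplies the probability of x by p_ij times an
   explicit factor, so the unknown 1 / p_ij disappears. *)
Lemma integral_shift (p : 'M[R]_(m, N)) (h : 'M[nat]_(m, N) -> R) i j :
  D_prod R m N p -> (forall x, 0 <= h x) -> (forall x : 'M[nat]_(m, N), x i j = 0%N -> h x = 0) ->
  (\int[P p]_w (h (X w) / p i j)%:E =
   \int[P p]_w (h (shift_at (X w) i j) *
     ((r + (col_total (X w) j)%:R) / (X w i j).+1%:R))%:E)%E.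
Proof.
move=> Dp h0 hx; have pij := D_prod_gt0 i j Dp.
have c0 (x : 'M[nat]_(m, N)) : 0 <= (r + (col_total x j)%:R) / (x i j).+1%:R.
  by rewrite divr_ge0// addr_ge0// ltW.
rewrite (ge0_integral_model (f := fun x => h x / p i j) model Dp); last first.
  by move=> x; rewrite divr_ge0// ltW.
rewrite (ge0_integral_model (f := fun x => h (shift_at x i j) *
     ((r + (col_total x j)%:R) / (x i j).+1%:R)) model Dp); last first.
  by move=> x; rewrite mulr_ge0.
rewrite (esumID (range (fun x => shift_at x i j)))/=; last first.
  by move=> x _; rewrite lee_fin mulr_ge0 ?divr_ge0 ?(ltW pij)// ltW// NM_joint_gt0.
(* A matrix that is not a shift has entry 0 at [(i, j)], where [h] vanishes. *)
rewrite [X in (_ + X)%E]esum1 ?adde0; last first.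
  move=> x [_ xr]; rewrite hx ?mul0r//; apply/eqP/negPn/negP => xij; apply: xr.
  exists (\matrix_(k, l) (x k l - ((k == i) && (l == j)))%N) => //.
  apply/matrixP => k l; rewrite !mxE subnK//.
  by case: eqVneq => //= ->; case: eqVneq => //= ->; rewrite lt0n.
rewrite setTI (@reindex_esum _ _ _ setT _ (fun x => shift_at x i j)); last first.
  split=> //; move=> x y _ _ /matrixP xy; apply/matrixP => k l.
  by have := xy k l; rewrite !mxE => /addIn.
apply: eq_esum => x _; congr EFin; rewrite NM_joint_shift.
have : (x i j).+1%:R != 0 :> R by rewrite pnatr_eq0.
move: (_.+1%:R) => c cN0.
by field; rewrite cN0 gt_eqF.
Qed.

Lemma integrable_bounded_model (p : 'M[R]_(m, N)) (f : 'M[nat]_(m, N) -> R) (c : R) :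
  (forall x, 0 <= f x <= c) ->
  (P p).-integrable setT (EFin \o (fun w => f (X w))).
Proof.
move=> fc; apply: (le_integrable _ _ _ (finite_measure_integrable_cst (P p) c measurableT)) => //.
  apply/measurable_EFinP; apply: (measurable_fun_discrete f).
  exact: measurable_model model.
move=> w _ /=; have /andP[f0 fle] := fc (X w).
by rewrite lee_fin !ger0_norm// (le_trans f0).
Qed.

(** Expand each loss term as [dh ^+ 2 / p - 2 * dh + p] and shift the quadratic part; vanishing of
    [dh] at zero entries permits the shift. The leftover sum of [p i j] is the same for every
    estimator. *)
Lemma riskE (n : nat) (p : 'M[R]_(m, N)) (dh : 'M[nat]_(m, N) -> 'M[R]_(m, N)) :
  D_prod R m N p -> (forall x i j, 0 <= dh x i j <= 1) ->
  (forall (x : 'M[nat]_(m, N)) i j, x i j = 0%N -> dh x i j = 0) ->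
  (P p).-integrable setT (EFin \o (fun w => unbiased_risk n r dh (X w))) /\
  risk P X (@loss R m N n) dh p =
  (\int[P p]_w unbiased_risk n r dh (X w) +
   \sum_(j < N | (j < n)%N) \sum_(i < m) p i j)%:E.
Proof.
move=> Dp d01 dx0.
have p0 i j : 0 < p i j := D_prod_gt0 i j Dp.
pose h i j (x : 'M[nat]_(m, N)) := dh x i j ^+ 2.
pose H i j (x : 'M[nat]_(m, N)) := h i j (shift_at x i j) *
  ((r + (col_total x j)%:R) / (x i j).+1%:R).
have H0 i j x : 0 <= H i j x.
  by rewrite mulr_ge0 ?sqr_ge0// divr_ge0// addr_ge0// ltW.
have id i j : (P p).-integrable setT (EFin \o (fun w => dh (X w) i j)).
  by apply: (@integrable_bounded_model p (fun x => dh x i j) 1).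
have iq i j : (P p).-integrable setT (EFin \o (fun w => h i j (X w) / p i j)).
  apply: (@integrable_bounded_model p (fun x => h i j x / p i j) (p i j)^-1) => x.
  have /andP[x0 x1] := d01 x i j.
  by rewrite divr_ge0 ?sqr_ge0 ?(ltW (p0 _ _))//= ler_piMl ?invr_ge0 ?(ltW (p0 _ _))// expr_le1.
have qH i j : (\int[P p]_w (h i j (X w) / p i j)%:E = \int[P p]_w (H i j (X w))%:E)%E.
  apply: integral_shift => //; first by move=> x; exact: sqr_ge0.
  by move=> x /dx0 xij; rewrite /h xij expr0n.
(* The factor [(r + z) / (x + 1)] comes with no uniform bound, so integrability is transferred from
   the bounded unshifted side through [qH]. *)
have iH i j : (P p).-integrable setT (EFin \o (fun w => H i j (X w))).
  apply/integrableP; split.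
    apply/measurable_EFinP; apply: (measurable_fun_discrete (H i j)).
    exact: measurable_model model.
  have /integrableP[_] := iq i j.
  under eq_integral do rewrite /= ger0_norm ?divr_ge0 ?sqr_ge0 ?(ltW (p0 _ _))//.
  under [X in _ -> (X < _)%E]eq_integral do rewrite /= ger0_norm//.
  by rewrite qH.
have RqH i j : \int[P p]_w (h i j (X w) / p i j) = \int[P p]_w H i j (X w).
  by rewrite /Rintegral qH.
have i2d i j : (P p).-integrable setT (EFin \o (fun w => 2 * dh (X w) i j)).
  exact: (integrableZl measurableT 2 (id i j)).
have iHd i j : (P p).-integrable setT (EFin \o (fun w => H i j (X w) - 2 * dh (X w) i j)).
  exact: (integrableB measurableT (iH i j) (i2d i j)).
have iqd i j : (P p).-integrable setT (EFin \o (fun w => h i j (X w) / p i j - 2 * dh (X w) i j)).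
  exact: (integrableB measurableT (iq i j) (i2d i j)).
have ip i j : (P p).-integrable setT (EFin \o (fun _ => p i j)).
  exact: finite_measure_integrable_cst.
have iL i j : (P p).-integrable setT
    (EFin \o (fun w => h i j (X w) / p i j - 2 * dh (X w) i j + p i j)).
  exact: (integrableD measurableT (iqd i j) (ip i j)).
have iU : (P p).-integrable setT (EFin \o (fun w => unbiased_risk n r dh (X w))).
  by apply: integrable_sumR => j _; apply: integrable_sumR => i _; exact: iHd.
split=> //.
have lossE w : loss n (dh (X w)) p = \sum_(j < N | (j < n)%N) \sum_(i < m)
    (h i j (X w) / p i j - 2 * dh (X w) i j + p i j).
  apply: eq_bigr => j _; apply: eq_bigr => i _; rewrite /h.
  by field; rewrite gt_eqF.
rewrite /risk unlock.
transitivity (\int[P p]_w loss n (dh (X w)) p)%:E.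
  rewrite /Rintegral fineK//.
  apply: (@integrable_fin_num _ _ _ _ _ _ (EFin \o (fun w => loss n (dh (X w)) p))) => //.
  under eq_fun do rewrite lossE.
  by apply: integrable_sumR => j _; apply: integrable_sumR => i _; exact: iL.
congr EFin.
transitivity (\int[P p]_w (\sum_(j < N | (j < n)%N) \sum_(i < m)
    (h i j (X w) / p i j - 2 * dh (X w) i j + p i j))).
  by apply: eq_Rintegral => w _; exact: lossE.
rewrite Rintegral_sum; last first.
  by move=> j _; apply: integrable_sumR => i _; exact: iL.
rewrite Rintegral_sum; last first.
  by move=> j _; apply: integrable_sumR => i _; exact: iHd.
rewrite -big_split/=; apply: eq_bigr => j _.
rewrite Rintegral_sum; last by move=> i _; exact: iL.
rewrite Rintegral_sum; last by move=> i _; exact: iHd.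
rewrite -big_split/=; apply: eq_bigr => i _.
rewrite RintegralD// RintegralB// RqH -RintegralB// Rintegral_cst//.
suff -> : fine (P p [set: T]) = 1 by rewrite mulr1.
rewrite -[RHS]/(fine 1%E); congr fine.
exact: probability_setT.
Qed.

End risk.

Lemma shrunk_estimator_bound (R : realType) (m N : nat) (r : R) (x : 'M[nat]_(m, N))
    i j (D : R) : 3 <= r -> 0 <= D ->
  0 <= (x i j)%:R / (r + (col_total x j)%:R - 1 + D) <= 1.
Proof.
move=> r3 D0; have xz : (x i j)%:R <= (col_total x j)%:R :> R.
  by rewrite ler_nat /col_total (bigD1 i)//= leq_addr.
have x0 : 0 <= (x i j)%:R :> R by rewrite ler0n.
have c0 : 0 < r + (col_total x j)%:R - 1 + D by lra.
by rewrite divr_ge0 ?(ltW c0)//= ler_pdivrMr// mul1r; lra.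
Qed.

(** Covers both estimators: [D = 0] is the UMVU estimator and [D = dl] the hierarchical Bayes one.
    The shift turns [r + z - 1] into [r + z] and [x ^+ 2] into [(x + 1) ^+ 2]; one power cancels,
    and the remaining [x + 1] sum to [z + m] over the column. *)
Lemma unbiased_risk_shrunk (R : realType) (m N n : nat) (r : R)
    (D : ('I_N -> nat) -> R) (dh : 'M[nat]_(m, N) -> 'M[R]_(m, N)) :
  (forall x i j, dh x i j = (x i j)%:R / (r + (col_total x j)%:R - 1 + D (col_total x))) ->
  forall x, unbiased_risk n r dh x = let z := col_total x in
    \sum_(j < N | (j < n)%N)
      (((z j)%:R + m%:R) * ((r + (z j)%:R) / (r + (z j)%:R + D (incr_at z j)) ^+ 2)
       - 2 * ((z j)%:R / (r + (z j)%:R - 1 + D z))).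
Proof.
move=> dhE x /=; apply: eq_bigr => j _.
set z := col_total x.
rewrite sumrB -mulr_sumr; congr (_ - 2 * _); last first.
  have zE : (z j)%:R = \sum_i (x i j)%:R :> R by rewrite /z /col_total natr_sum.
  rewrite [X in X / _]zE mulr_suml; apply: eq_bigr => i _.
  by rewrite dhE.
have -> : (z j)%:R + m%:R = \sum_(i < m) ((x i j)%:R + 1) :> R.
  by rewrite big_split/= sumr_const card_ord -natr_sum.
rewrite mulr_suml; apply: eq_bigr => i _.
rewrite dhE col_total_shift -/z !mxE !eqxx/= addn1 {1}/incr_at eqxx addn1.
rewrite -(natr1 (z j)) addrA addrK -natr1.
have : (x i j)%:R + 1 != 0 :> R by rewrite natr1 pnatr_eq0.
move: (_ + 1) => c c0; rewrite expr_div_n.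
have -> : c ^+ 2 / (r + (z j)%:R + D (incr_at z j)) ^+ 2 * ((r + (z j)%:R) / c) =
  c ^+ 2 / c * ((r + (z j)%:R) / (r + (z j)%:R + D (incr_at z j)) ^+ 2) by rewrite mulrACA [RHS]mulrACA [X in _ * X]mulrC.
by rewrite expr2 mulfK.
Qed.

(** * Domination of the UMVU estimator *)

Unset Implicit Arguments.

Theorem theorem3p1 (R : realType) (d : measure_display) (T : measurableType d)
    (m N n : nat) (r alpha beta : R) (g : R -> R)
    (P : 'M[R]_(m, N) -> probability T R) (X : T -> 'M[nat]_(m, N)) :
  (1 <= m)%N -> (1 <= N)%N -> (1 <= n <= N)%N ->
  0 < r -> 0 < alpha -> 0 <= beta ->
  NM_model r P X ->
  (forall t, 0 < t -> 0 < g t) ->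
  (exists M, forall t, 0 < t -> g t <= M) ->
  smooth_pos g ->
  condA1 m N r alpha beta g \/ condA2 m N r alpha beta g ->
  {in `]0, +oo[ &, nonincreasing_fun g} ->
  alpha + 1 <= Num.min (n%:R * (m%:R - 2)) (n%:R * m%:R / 2 + beta * r) ->
  dominates P X (@loss R m N n)
    (p_HB r alpha beta g) (@p_UMVU R m N r).
Proof.
move=> m1 N1 nN r0 alpha0 beta0 model g0 gM sg A12 gni.
rewrite le_min => /andP[an _].
have mr := le_m_r A12.
have nR : 0 < n%:R :> R by rewrite ltr0n; case/andP: nN.
(* As [alpha + 1] is positive, [n * (m - 2)] must be positive too. *)
have m3 : (3 <= m)%N.
  rewrite ltnNge; apply/negP => m2.
  have mR : m%:R <= 2 :> R by rewrite ler_nat.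
  have := mulr_ge0 (ltW nR) (_ : 0 <= 2 - m%:R); rewrite subr_ge0 => /(_ mR); lra.
have m3R : 3 <= m%:R :> R by rewrite ler_nat.
pose W (z : 'I_N -> nat) := hb_weight m r alpha beta g z.
pose dl z := integral0y (fun t => t * W z t) / integral0y (W z).
have W0 z t : 0 < t -> 0 < W z t by exact: hb_weight_gt0.
have Wi z : integrable0y (W z) by exact: integrable_hb_weight A12 z.
have dl0 z : 0 <= dl z.
  apply: divr_ge0; apply: integral0y_ge0 => t t0; last exact/ltW/W0.
  by apply: mulr_ge0; [exact: ltW|exact/ltW/W0].
have UE (x : 'M[nat]_(m, N)) i j : p_UMVU r x i j =
    (x i j)%:R / (r + (col_total x j)%:R - 1 + (fun=> 0) (col_total x)).
  by rewrite mxE addr0; case: posnP => // ->; rewrite mul0r.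
have HE (x : 'M[nat]_(m, N)) i j : p_HB r alpha beta g x i j =
    (x i j)%:R / (r + (col_total x j)%:R - 1 + dl (col_total x)).
  rewrite mxE; case: posnP => [->|xij]; first by rewrite mul0r.
  (* A positive entry makes the total of its column nonzero, and there the numerator of [delta] is
     finite. *)
  have zj : col_total x j != 0%N.
    by rewrite -lt0n (leq_trans xij)// /col_total (bigD1 i)//= leq_addr.
  rewrite (delta_hbE m1 alpha0 beta0 g0 gM sg A12); last first.
    exact: (integrable_id_mul_hb_weight m1 alpha0 beta0 g0 gM sg A12 zj).
  rewrite -EFinD inver gt_eqF//.
  have := dl0 (col_total x); have := ler0n R (col_total x j); rewrite /dl /W; lra.
have r3 : 3 <= r by exact: le_trans mr.
have dle (x : 'M[nat]_(m, N)) : unbiased_risk n r (p_HB r alpha beta g) x <= unbiased_risk n r (p_UMVU r) x /\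
    ((forall i, col_total x i = 0%N) ->
     unbiased_risk n r (p_HB r alpha beta g) x < unbiased_risk n r (p_UMVU r) x).
  have -> : unbiased_risk n r (p_UMVU r) x = let z := col_total x in
    \sum_(j < N | (j < n)%N)
      (((z j)%:R + m%:R) * ((r + (z j)%:R) / (r + (z j)%:R) ^+ 2)
       - 2 * ((z j)%:R / (r + (z j)%:R - 1))).
    rewrite (@unbiased_risk_shrunk _ _ _ n r (fun=> 0) _ UE) /=.
    by apply: eq_bigr => j _; rewrite !addr0.
  rewrite (@unbiased_risk_shrunk _ _ _ n r dl _ HE).
  apply: (@posterior_shrinkage_le _ m N n r (alpha + 1) W) => //.
    by move=> z i t _; exact: hb_weight_incr.
  by move=> z; exact: hb_weight_log_derivative.
have HB01 (x : 'M[nat]_(m, N)) i j : 0 <= p_HB r alpha beta g x i j <= 1.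
  by rewrite HE shrunk_estimator_bound.
have HBx0 (x : 'M[nat]_(m, N)) i j : x i j = 0%N -> p_HB r alpha beta g x i j = 0.
  by rewrite HE => ->; rewrite mul0r.
have U01 (x : 'M[nat]_(m, N)) i j : 0 <= p_UMVU r x i j <= 1.
  by rewrite UE shrunk_estimator_bound.
have Ux0 (x : 'M[nat]_(m, N)) i j : x i j = 0%N -> p_UMVU r x i j = 0.
  by rewrite UE => ->; rewrite mul0r.
split=> [p Dp|].
  have [iH ->] := riskE r0 model n Dp HB01 HBx0.
  have [iU ->] := riskE r0 model n Dp U01 Ux0.
  rewrite lee_fin lerD2r; apply: le_Rintegral => // w _.
  by have [] := dle (X w).
(* A concrete point of the parameter set: each column sums to [m / (m + 1) < 1]. *)
pose p : 'M[R]_(m, N) := const_mx (m.+1%:R^-1).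
have Dp : D_prod R m N p.
  move=> j; split=> [i|]; first by rewrite !mxE invr_gt0 ltr0n.
  under eq_bigr do rewrite !mxE.
  by rewrite sumr_const card_ord -[_ *+ m]mulr_natl ltr_pdivrMr ?ltr0n// mul1r ltr_nat.
exists p => //.
have [iH ->] := riskE r0 model n Dp HB01 HBx0.
have [iU ->] := riskE r0 model n Dp U01 Ux0.
rewrite lte_fin ltrD2r -subr_gt0 -RintegralB//.
pose gap (x : 'M[nat]_(m, N)) := unbiased_risk n r (p_UMVU r) x - unbiased_risk n r (p_HB r alpha beta g) x.
have gap0 : 0 < gap 0.
  by rewrite subr_gt0; apply (dle 0).2 => i; rewrite /col_total big1// => k _; rewrite mxE.
have mX0 := measurable_model model 0.
pose A := [set w | X w = 0].
have iA : (P p).-integrable setT (EFin \o (fun w => gap 0 * \1_A w)).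
  exact: (integrableZl measurableT (gap 0) (integrable_indic _ mX0)).
(* The difference of the risk estimates is nonnegative everywhere and equals [gap 0 > 0] on the
   event [X = 0], which has positive probability. *)
apply: (@lt_le_trans _ _ (\int[P p]_w (gap 0 * \1_A w))).
  rewrite RintegralZl//; last exact: integrable_indic.
  rewrite mulr_gt0// /Rintegral integral_indic// setIT.
  have PA : P p A = (NM_joint r p 0)%:E := model_pmf model 0 Dp.
  have J0 := NM_joint_gt0 r0 0 Dp.
  suff -> : fine (P p A) = NM_joint r p 0 by [].
  by move: (P p A) PA => q ->.
have iUH := integrableB measurableT iU iH.
apply: (le_Rintegral measurableT iA iUH) => w _; rewrite indicE; have [/[!inE] wA|_] := boolP (w \in A).
  have -> : X w = 0 := wA.
  by rewrite mulr1 lexx.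
by rewrite mulr0 subr_ge0; have [] := dle (X w).
Qed.
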